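(* Let $\Omega\subset\mathbb R^n$ be open, let $u\in L^1_{\mathrm{loc}}(\Omega;V)$ and assume that $\mathcal Au\in\mathcal M(\Omega;W)$. Then, at $|\mathcal Au|$-almost every $x\in\Omega$ where $u$ is approximately Lebesgue continuous, it holds $$\limsup_{r\to0^+}\frac{|\mathcal Au|(B_r(x))}{r^{n-1}}=0.$$ In particular, $$|\mathcal Au|\left(\Theta^{n-1}(\mathcal Au)\setminus S_u\right)=0.$$
   Context: $V,W$ are finite-dimensional inner product spaces, $A_1,\dots,A_n\in\mathrm{Hom}(V,W)$, and $\mathcal A=\sum_{i=1}^nA_i\partial_i$ acts on $V$-valued distributions with values in $W$-valued distributions. $\mathcal M(\Omega;W)$ is the space of locally bounded $W$-valued Borel measures on $\Omega$; $|\mu|$ is the total variation measure of $\mu$. A point $x\in\Omega$ is a Lebesgue point of $u$ (a point where $u$ is approximately Lebesgue continuous) if there is $z\in V$ with $$\limsup_{r\to0}\frac{1}{|B_r(x)|}\int_{B_r(x)}|u(y)-z|\,dy=0.$$ $S_u$ is the set of points of $\Omega$ that are not Lebesgue points of $u$. For a vector-valued measure $\mu$, $\Theta^{n-1}(\mu)$ is the set of points $x$ with $\limsup_{r\to0}|\mu|(B_r(x))/r^{n-1}>0$. *)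

(* Defs.v *)
From HB Require Import structures.
From mathcomp Require Import all_boot all_order all_algebra.
From mathcomp Require Import sesquilinear.
From mathcomp Require Import all_classical all_reals all_analysis.
From mathcomp Require Import measurable_realfun.

Set Implicit Arguments.
Unset Strict Implicit.
Unset Printing Implicit Defensive.

Import Order.TTheory GRing.Theory Num.Theory.
Import numFieldNormedType.Exports.

Local Open Scope classical_set_scope.
Local Open Scope ring_scope.

HB.instance Definition _ (R : realType) m n :=
  Measurable.copy 'M[R]_(m, n) (g_sigma_algebraType (@open 'M[R]_(m, n))).

Section borel_rV.
Context {R : realType}.

Lemma open_measurable_rV n (U : set 'rV[R]_n) : open U -> measurable U.
Proof. by move=> oU; exact: sub_sigma_algebra. Qed.

Lemma measurable_coord n (i : 'I_n) :
  measurable_fun [set: 'rV[R]_n] (fun x : 'rV[R]_n => x ord0 i).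
Proof.
apply: (measurability _ (RGenOpens.measurableE R)) => _ [_ [a [b ->]] <-].
rewrite setTI; apply: open_measurable_rV.
apply: open_comp; last exact: interval_open.
by move=> x _; exact: coord_continuous.
Qed.

Lemma measurable_fun_rV d (T : measurableType d) n (f : T -> 'rV[R]_n) :
  (forall i, measurable_fun setT (fun t => f t ord0 i)) ->
  measurable_fun setT f.
Proof.
move=> mf; apply: (measurability (@open 'rV[R]_n)) => // _ [U oU <-].
rewrite setTI.
pose box (q : {ffun 'I_n -> rat} * nat) :=
  [set x : 'rV[R]_n | forall i, `|x ord0 i - ratr (q.1 i)| < q.2.+1%:R^-1].
have -> : U = \bigcup_(q in [set q | box q `<=` U]) box q.
  apply/seteqP; split=> [x Ux|x [q /= qU]]; last exact: qU.
  have /nbhs_ballP[e /= e0 xeU] : nbhs x U by exact: open_nbhs_nbhs.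
  have [k /ltW ke] : exists k : nat, k.+1%:R^-1 < e / 2.
    exists (Num.truncn ((e / 2)^-1)).
    rewrite -[ltRHS]invrK ltf_pV2 ?posrE ?invr_gt0 ?divr_gt0//.
    by rewrite truncnS_gt.
  have qP i : exists q : rat, `|x ord0 i - ratr q| < k.+1%:R^-1.
    have [|q] := @rat_in_itvoo R (x ord0 i) (x ord0 i + k.+1%:R^-1).
      by rewrite ltrDl invr_gt0.
    rewrite in_itv/= => /andP[xq qx]; exists q.
    by rewrite ltr0_norm ?subr_lt0// opprB ltrBlDl.
  exists ([ffun i => sval (cid (qP i))], k).
    move=> y /= yq; apply: xeU; split=> // i j; rewrite ord1 /ball/=.
    move: (yq j); rewrite ffunE; case: cid => q /= qx yqk.
    rewrite (splitr e) -(subrKA (ratr q)) (le_lt_trans (ler_normD _ _))//.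
    rewrite ltrD ?(lt_le_trans qx)// distrC; exact: lt_le_trans yqk _.
  by move=> i /=; rewrite ffunE; case: cid.
rewrite preimage_bigcup bigcup_mkcond.
apply: countable_bigcupT_measurable => [|q]; first exact: countableP.
case: ifPn => // _.
rewrite (_ : _ @^-1` _ = \bigcap_(i in [set: 'I_n])
   ((fun t => f t ord0 i) @^-1`
     [set r | `|r - ratr (q.1 i)| < q.2.+1%:R^-1])); last first.
  by apply/seteqP; split=> [t ft i _ //|t ft i /=]; exact: ft.
apply: fin_bigcap_measurable => // i _.
rewrite -[X in measurable X]setTI; apply: mf => //.
rewrite (_ : mkset _ = ball (ratr (q.1 i) : R) q.2.+1%:R^-1).
  exact: measurable_ball.
by apply/seteqP; split=> y; rewrite /= /ball/= distrC.
Qed.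

Definition consrV n (p : measurableTypeR R * 'rV[R]_n) : 'rV[R]_n.+1 :=
  \row_i oapp (p.2 ord0) p.1 (unlift ord0 i).

Lemma measurable_consrV n : measurable_fun setT (@consrV n).
Proof.
apply: measurable_fun_rV => i; under eq_fun do rewrite mxE.
case: (unlift ord0 i) => [j|] /=; last exact: measurable_fst.
apply: (@measurableT_comp _ _ _ _ _ _ (fun x : 'rV[R]_n => x ord0 j) _ snd).
  exact: measurable_coord.
exact: measurable_snd.
Qed.

End borel_rV.

Section lebesgue_rV.
Context {R : realType}.
Local Open Scope ereal_scope.

Section step.
Context {n : nat} (m : {sigma_finite_measure set 'rV[R]_n -> \bar R}).

Definition lebesgue_step : set 'rV[R]_n.+1 -> \bar R :=
  pushforward (@lebesgue_measure R \x m) (@consrV R n).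

Let step0 : lebesgue_step set0 = 0.
Proof. by rewrite /lebesgue_step /pushforward preimage_set0 measure0. Qed.

Let step_ge0 A : 0 <= lebesgue_step A.
Proof.
pose p : {measure set (measurableTypeR R * 'rV[R]_n) -> \bar R} :=
  @lebesgue_measure R \x m.
exact: (measure_ge0 p).
Qed.

Let step_sigma_additive : semi_sigma_additive lebesgue_step.
Proof.
move=> F mF tF mUF; rewrite /lebesgue_step /pushforward preimage_bigcup.
apply: measure_semi_sigma_additive.
- by move=> i; rewrite -[X in measurable X]setTI; exact: measurable_consrV.
- apply/trivIsetP => /= i j _ _ ij; rewrite -preimage_setI.
  by move/trivIsetP : tF => /(_ _ _ _ _ ij) ->//; rewrite preimage_set0.
- rewrite -preimage_bigcup -[X in measurable X]setTI.
  exact: measurable_consrV.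
Qed.

HB.instance Definition _ := isMeasure.Build _ _ _ lebesgue_step
  step0 step_ge0 step_sigma_additive.

Let step_sigma_finite : sigma_finite setT lebesgue_step.
Proof.
have [F FT Foo] := sigma_finiteT (@lebesgue_measure R).
have [G GT Goo] := sigma_finiteT m.
pose unpair k : nat * nat := odflt (0, 0)%N (unpickle k).
pose hd (x : 'rV[R]_n.+1) := x ord0 ord0.
pose tl (x : 'rV[R]_n.+1) : 'rV[R]_n := \row_j x ord0 (lift ord0 j).
have mhd : measurable_fun setT hd by exact: measurable_coord.
have mtl : measurable_fun setT tl.
  apply: measurable_fun_rV => i; under eq_fun do rewrite mxE.
  exact: measurable_coord.
exists (fun k => hd @^-1` F (unpair k).1 `&` tl @^-1` G (unpair k).2).
  apply/esym; rewrite -subTset => x _.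
  have : [set: R] (hd x) by []. have : setT (tl x) by [].
  rewrite [X in X _ -> _]GT => -[j _ Gj]; rewrite [X in X _ -> _]FT => -[i _ Fi].
  by exists (pickle (i, j)) => //; rewrite /unpair /= pickleK.
move=> k; have [mF Fk] := Foo (unpair k).1; have [mG Gk] := Goo (unpair k).2.
split.
  by apply: measurableI; rewrite -[X in measurable X]setTI; [exact: mhd|exact: mtl].
rewrite /lebesgue_step /pushforward (_ : _ @^-1` _ = F (unpair k).1 `*` G (unpair k).2).
  by rewrite product_measure1E// lte_mul_pinfty// ge0_fin_numE.
have hdE x (y : 'rV[R]_n) : hd (consrV (x, y)) = x by rewrite /hd mxE unlift_none.
have tlE x (y : 'rV[R]_n) : tl (consrV (x, y)) = y.
  by apply/rowP => j; rewrite !mxE liftK.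
by apply/seteqP; split=> -[x y] /=; rewrite hdE tlE.
Qed.

HB.instance Definition _ := Measure_isSigmaFinite.Build _ _ _ lebesgue_step
  step_sigma_finite.

End step.

Fixpoint lebesgue_rV n : {sigma_finite_measure set 'rV[R]_n -> \bar R} :=
  match n with
  | 0 => \d_(0%R : 'rV[R]_0)
  | n'.+1 => lebesgue_step (lebesgue_rV n')
  end.

Lemma lebesgue_rV_box n (a b : 'I_n -> R) : (forall i, (a i <= b i)%R) ->
  lebesgue_rV n [set x | forall i, (a i < x ord0 i <= b i)%R] =
  \prod_(i < n) (b i - a i)%:E.
Proof.
elim: n a b => [|n IH] a b ab.
  by rewrite big_ord0 /= diracE mem_set// => -[].
rewrite big_ord_recl /= /lebesgue_step /pushforward.
rewrite (_ : _ @^-1` _ = `]a ord0, b ord0]%classic `*`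
    [set x : 'rV[R]_n | forall i,
      (a (lift ord0 i) < x ord0 i <= b (lift ord0 i))%R]); last first.
  apply/seteqP; split=> [[x y] /= H|[x y] /= [+ H] i].
    split; first by have := H ord0; rewrite mxE unlift_none/= in_itv.
    by move=> i; have := H (lift ord0 i); rewrite mxE liftK.
  rewrite in_itv/= mxE => xab; case: unliftP => [j|] ->//=; exact: H.
rewrite product_measure1E//=.
- rewrite IH// lebesgue_measure_itv/= lte_fin; case: ltgtP (ab ord0) => // ->.
  by rewrite subrr.
- rewrite (_ : mkset _ = \bigcap_(i in [set: 'I_n]) ((fun x : 'rV[R]_n => x ord0 i)
      @^-1` `]a (lift ord0 i), b (lift ord0 i)]%classic)); last first.
    by apply/seteqP; split=> [x H i _|x H i]; [rewrite /= in_itv; exact: H|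
      have := H i I; rewrite /= in_itv].
  apply: fin_bigcap_measurable => // i _; rewrite -[X in measurable X]setTI.
  exact: measurable_coord.
Qed.

End lebesgue_rV.

Section euclidean.
Context {R : realType} {n : nat}.

(* The norm [`|x|] of the library on ['rV[R]_n] is the maximum norm. *)
Definition enorm (x : 'rV[R]_n) : R := Num.sqrt (\sum_i x ord0 i ^+ 2).

Definition eball (x : 'rV[R]_n) (r : R) : set 'rV[R]_n :=
  [set y | enorm (y - x) < r].

Definition partial (i : 'I_n) (phi : 'rV[R]_n -> R) : 'rV[R]_n -> R :=
  fun x => 'D_(delta_mx ord0 i) phi x.

Definition smooth (phi : 'rV[R]_n -> R) := forall s : seq 'I_n,
  continuous (foldr partial phi s) /\
  forall x i, derivable (foldr partial phi s) x (delta_mx ord0 i).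

Definition test_function (Omega : set 'rV[R]_n) (phi : 'rV[R]_n -> R) :=
  [/\ smooth phi,
      compact (closure [set x | phi x != 0]) &
      closure [set x | phi x != 0] `<=` Omega].

End euclidean.

Definition dnorm {R : realType} {V : vectType R} (dV : {dot V for idfun})
  (v : V) : R := Num.sqrt (dV v v).

Section locally_integrable.
Context {R : realType} {n : nat} {V : vectType R} (dV : {dot V for idfun}).
Implicit Types (Omega : set 'rV[R]_n) (u : 'rV[R]_n -> V).

(* Elements of L^1_loc are represented by Borel functions on [Omega]; the
   values of [u] outside [Omega] are irrelevant. *)
Definition L1loc Omega u :=
  (forall v, measurable_fun Omega (fun x => dV (u x) v)) /\
  (forall K, compact K -> K `<=` Omega ->
    (\int[lebesgue_rV n]_(x in K) (dnorm dV (u x))%:E < +oo)%E).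

Definition average (f : 'rV[R]_n -> R) (B : set 'rV[R]_n) : \bar R :=
  ((fine (lebesgue_rV n B))^-1%:E * \int[lebesgue_rV n]_(y in B) (f y)%:E)%E.

Definition Lebesgue_point u (x : 'rV[R]_n) := exists z : V,
  limf_esup (fun r : R => average (fun y => dnorm dV (u y - z)) (eball x r))
    0^'+ = 0%E.

Definition discontinuity_set Omega u : set 'rV[R]_n :=
  [set x | Omega x /\ ~ Lebesgue_point u x].

End locally_integrable.

Section distributions.
Context {R : realType} {n : nat} {V W : vectType R}.
Implicit Types (phi : 'rV[R]_n -> R) (T : ('rV[R]_n -> R) -> V).

(* A [V]-valued distribution is represented by its action on scalar test
   functions. *)

Definition vector_integral (D : set 'rV[R]_n) (f : 'rV[R]_n -> V) : V :=
  \sum_(i < \dim {:V})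
    (\int[lebesgue_rV n]_(x in D) coord (vbasis {:V}) i (f x))%R
      *: (vbasis {:V})`_i.

Definition distribution_of (Omega : set 'rV[R]_n) (u : 'rV[R]_n -> V) :
    ('rV[R]_n -> R) -> V :=
  fun phi => vector_integral Omega (fun x => phi x *: u x).

Definition distr_partial (i : 'I_n) T : ('rV[R]_n -> R) -> V :=
  fun phi => - T (partial i phi).

Definition diff_operator (A : 'I_n -> 'Hom(V, W)) T : ('rV[R]_n -> R) -> W :=
  fun phi => \sum_(i < n) A i (distr_partial i T phi).

End distributions.

Section vector_measures.
Import HBSimple.
Context {R : realType} {n : nat} {W : vectType R} (dW : {dot W for idfun}).
Variables (Omega : set 'rV[R]_n) (mu : set 'rV[R]_n -> W).

Definition compactly_inside (A : set 'rV[R]_n) :=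
  exists K, [/\ compact K, A `<=` K & K `<=` Omega].

Definition countable_partition (A : set 'rV[R]_n) (F : (set 'rV[R]_n)^nat) :=
  [/\ (forall k, measurable (F k)), (forall k, compactly_inside (F k)),
      trivIset setT F & \bigcup_k F k = A].

(* [mu A] is meaningful only for Borel sets [A] satisfying [compactly_inside A]:
   a locally bounded vector measure need not extend to all Borel subsets of
   [Omega], but its total variation does. On sets [A] such that [A `&` Omega]
   is not Borel, [variation_measure A] is the supremum of the empty set, so
   null sets have to be expressed with [negligible]. *)
Definition variation_measure (A : set 'rV[R]_n) : \bar R :=
  ereal_sup [set (\sum_(k <oo) (dnorm dW (mu (F k)))%:E)%E |
    F in countable_partition (A `&` Omega)].

Definition locally_bounded_measure :=
  (forall A F, compactly_inside A -> countable_partition A F ->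
    dnorm dW (\sum_(k < N) mu (F k) - mu A) @[N --> \oo] --> 0) /\
  (forall K, compact K -> K `<=` Omega -> (variation_measure K < +oo)%E).

Definition simple_integral (s : {sfun 'rV[R]_n >-> R}) : W :=
  \sum_(c \in range s) c *: mu (s @^-1` [set c]).

(* [v] is the integral of the bounded function [phi], which vanishes outside
   some compact subset [K] of [Omega], with respect to [mu]; the limit does not
   depend on the choice of [K] and of the approximating sequence. *)
Definition is_integral (phi : 'rV[R]_n -> R) (v : W) :=
  exists K (s : {sfun 'rV[R]_n >-> R}^nat),
  [/\ compact K /\ K `<=` Omega,
      (forall k x, ~ K x -> s k x = 0),
      (forall e, 0 < e ->
         \forall k \near \oo, forall x, `|s k x - phi x| < e) &
      dnorm dW (simple_integral (s k) - v) @[k --> \oo] --> 0].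

Definition represents_measure (T : ('rV[R]_n -> R) -> W) :=
  forall phi, test_function Omega phi -> is_integral phi (T phi).

Definition upper_density (d : nat) (x : 'rV[R]_n) : \bar R :=
  limf_esup (fun r : R => (variation_measure (eball x r) * (r ^- d)%:E)%E) 0^'+.

Definition Theta (d : nat) : set 'rV[R]_n :=
  [set x | Omega x /\ (0 < upper_density d x)%E].

End vector_measures.

(* Main.v *)
Require Import Defs.
From HB Require Import structures.
From mathcomp Require Import all_boot all_order all_algebra.
From mathcomp Require Import sesquilinear.
From mathcomp Require Import all_classical all_reals all_analysis.
From mathcomp Require Import measurable_realfun.
From mathcomp Require Import ring lra zify.

Set Implicit Arguments.
Unset Strict Implicit.
Unset Printing Implicit Defensive.

Import Order.TTheory GRing.Theory Num.Theory.
Import numFieldNormedType.Exports.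

Local Open Scope classical_set_scope.
Local Open Scope ring_scope.

(** Let [sigma] be the total variation of the measure [mu] representing [A u],
    let [x] be a Lebesgue point of [u], with value [z], and let [B_r] be the
    ball of radius [r] around [x] in the maximum norm, to which Euclidean balls
    are comparable.

    Since the operator annihilates constants, testing [mu] against a bump
    [phi] supported in [B_r] only sees [u - z]. The gradient of [phi] has size
    [1 / r] and the integral of [|u - z|] over [B_r] is [o(r ^ n)], hence the
    integral of [phi] against [mu] is [o(r ^ (n - 1))]
    ([diff_operator_bump_small]).

    To replace [mu] by [sigma], fix [lam > 0]. For [sigma]-almost every [x]
    there is a vector [w] with [|w| <= 1] such that the positive measure
    [sigma - <mu, w>], called [misalignment w] below, satisfies
    [misalignment w B_r <= lam * sigma B_(6 r)] for all small [r]
    ([exists_aligned_direction]). Indeed, cut a bounded region into Borel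
    pieces [F_k] for which the sum of the [|mu F_k|] is almost the full mass of
    [sigma], and let [w_k] be the direction of [mu F_k]: then
    [misalignment w_k F_k = sigma F_k - |mu F_k|] is small in total. A covering
    by maximal dyadic cubes ([frequent_ball_covering]) shows that a measure
    which gives little mass to [F_k] has small density, relative to [sigma] on
    balls six times larger, at all points of [F_k] but few.

    If [phi >= c > 0] on [B_(r / 2)], the two facts combine to
    [c * sigma B_(r / 2) <= o(r ^ (n - 1)) + lam * sigma B_(6 r)]
    ([is_integral_lower_bound]). With [h r = sigma B_r / r ^ (n - 1)] and [lam]
    small enough this reads [h r <= eps + h (12 * r) / 2] for small [r]. As
    [h] is bounded on radii bounded away from [0], iterating the inequality over
    the scales [12 ^ j] gives [h r --> 0] ([halving_iteration]): the factor [1 / 2]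
    pays for comparing a ball with a larger one. *)

(** * Inner product spaces *)
Section inner_product.
Context {R : realType} {V : vectType R} (dV : {dot V for idfun}).

Lemma dotC u v : dV u v = dV v u.
Proof. by rewrite hermC expr0 mul1r. Qed.

Lemma dotDl u v w : dV (u + v) w = dV u w + dV v w.
Proof. exact: linearDl. Qed.

Lemma dotZl a u w : dV (a *: u) w = a * dV u w.
Proof. exact: linearZl_LR. Qed.

Lemma dotNl u w : dV (- u) w = - dV u w.
Proof. exact: linearNl. Qed.

Lemma dotDr u v w : dV w (u + v) = dV w u + dV w v.
Proof. by rewrite dotC dotDl !(dotC w). Qed.

Lemma dotZr a u w : dV w (a *: u) = a * dV w u.
Proof. by rewrite dotC dotZl (dotC w). Qed.

Lemma dot_suml I (r : seq I) (P : pred I) (F : I -> V) w :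
  dV (\sum_(i <- r | P i) F i) w = \sum_(i <- r | P i) dV (F i) w.
Proof. exact: linear_sumlz. Qed.

Lemma dot_gt0 u : u != 0 -> 0 < dV u u.
Proof. exact: neq0_dnorm_gt0. Qed.

Lemma dot_ge0 u : 0 <= dV u u.
Proof.
by have [->|u0] := eqVneq u 0; [rewrite linear0l|exact/ltW/dot_gt0].
Qed.

Lemma dnorm_ge0 u : 0 <= dnorm dV u.
Proof. exact: sqrtr_ge0. Qed.

Lemma sqr_dnorm u : dnorm dV u ^+ 2 = dV u u.
Proof. by rewrite sqr_sqrtr// dot_ge0. Qed.

Lemma dnorm0 : dnorm dV 0 = 0.
Proof. by rewrite /dnorm linear0l sqrtr0. Qed.

Lemma dnorm0_eq0 u : dnorm dV u = 0 -> u = 0.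
Proof.
move=> u0; apply/eqP/negPn/negP => /dot_gt0.
by rewrite -sqr_dnorm u0 expr0n ltxx.
Qed.

Lemma dnormZ a u : dnorm dV (a *: u) = `|a| * dnorm dV u.
Proof.
by rewrite /dnorm dotZl dotZr mulrA -expr2 sqrtrM ?sqr_ge0// sqrtr_sqr.
Qed.

Lemma dnormN u : dnorm dV (- u) = dnorm dV u.
Proof. by rewrite -scaleN1r dnormZ normrN normr1 mul1r. Qed.

Lemma cauchy_schwarz u v : `|dV u v| <= dnorm dV u * dnorm dV v.
Proof.
have [->|v0] := eqVneq v 0; first by rewrite dnorm0 mulr0 dotC linear0l normr0.
have vv0 : 0 < dV v v by exact: dot_gt0.
rewrite -(@ler_pXn2r _ 2)// ?nnegrE ?mulr_ge0 ?dnorm_ge0//.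
rewrite exprMn !sqr_dnorm real_normK ?num_real//.
have := dot_ge0 (u - (dV u v / dV v v) *: v).
rewrite dotDl !dotDr !dotNl -!scaleNr !dotZr -!dotZl !scaleNr !dotNl !dotZl (dotC v u).
rewrite -(pmulr_rge0 _ vv0) => h.
rewrite -subr_ge0; move: h.
set a := dV u v; set b := dV u u; set c := dV v v.
by move=> h; apply: le_trans h _; rewrite le_eqVlt; apply/orP; left; apply/eqP; field;
  rewrite gt_eqF.
Qed.

Lemma ler_dnormD u v : dnorm dV (u + v) <= dnorm dV u + dnorm dV v.
Proof.
rewrite -(@ler_pXn2r _ 2)// ?nnegrE ?addr_ge0 ?dnorm_ge0//.
rewrite sqrrD !sqr_dnorm dotDl !dotDr (dotC v u).
have := le_trans (ler_norm _) (cauchy_schwarz u v); lra.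
Qed.

Lemma ler_dnorm_sum I (r : seq I) (P : pred I) (F : I -> V) :
  dnorm dV (\sum_(i <- r | P i) F i) <= \sum_(i <- r | P i) dnorm dV (F i).
Proof.
elim/big_ind2 : _ => //; first by rewrite dnorm0.
by move=> x1 x2 y1 y2 h1 h2; rewrite (le_trans (ler_dnormD _ _))// lerD.
Qed.

Lemma ler_dnormB u v : `|dnorm dV u - dnorm dV v| <= dnorm dV (u - v).
Proof.
have h a b : dnorm dV a - dnorm dV b <= dnorm dV (a - b).
  by rewrite lerBlDr -{1}(subrK b a) ler_dnormD.
rewrite ler_norml h andbT lerNl opprB.
by rewrite -(dnormN (u - v)) opprB h.
Qed.

(** The map [e |-> <., e>] is injective into a space of the same dimension.
    It expresses coordinates in a basis as inner products, which makes them
    measurable along an integrable function and bounds them by the norm. *)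
Lemma riesz_representation (f : 'Hom(V, R^o)) : exists e, forall v, f v = dV v e.
Proof.
pose D (e : V) : 'Hom(V, R^o) := linfun (applyr dV e : V -> R^o).
have DE e v : D e v = dV v e by rewrite lfunE.
have Dlin : linear D.
  move=> a x y; apply/lfunP => v.
  by rewrite add_lfunE scale_lfunE !DE dotDr dotZr.
pose L : 'Hom(V, 'Hom(V, R^o)) :=
  linfun (HB.pack D (GRing.isLinear.Build _ _ _ _ D Dlin) : {linear _ -> _}).
have LE e : L e = D e by rewrite lfunE.
have L0 : lker L == 0%VS.
  apply/eqP/vspaceP => e; rewrite memv_ker memv0 LE.
  apply/eqP/eqP => [De0|->]; last first.
    by apply/lfunP => v; rewrite DE lfunE/= dotC linear0l.
  by apply: dnorm0_eq0; rewrite /dnorm -DE De0 lfunE sqrtr0.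
have : (limg L == fullv)%VS.
  rewrite -(geq_leqif (dimv_leqif_eq (subvf _))).
  rewrite (@limg_dim_eq _ _ _ L fullv) ?(eqP L0) ?capv0//.
  by rewrite !dimvf /dim/= muln1.
move/eqP => LT; have : f \in limg L by rewrite LT memvf.
by case/memv_imgP => e _ ->; exists e => v; rewrite LE DE.
Qed.

Lemma coord_dot (b : (\dim {:V}).-tuple V) (i : 'I_(\dim {:V})) :
  exists e, forall v, coord b i v = dV v e.
Proof.
have [e he] := riesz_representation (linfun (coord b i : V -> R^o)).
by exists e => v; rewrite -he lfunE.
Qed.

End inner_product.

(** * Borel sets and exhaustions *)
Section compactly_inside.
Context {R : realType} {n : nat}.
Implicit Types Omega A B : set 'rV[R]_n.

Lemma compactly_insideS Omega A B :
  A `<=` B -> compactly_inside Omega B -> compactly_inside Omega A.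
Proof. by move=> AB [K [cK BK KO]]; exists K; split=> //; exact: subset_trans BK. Qed.

(** [D k] consists of the points of norm below [k] whose distance to the
    complement of [Omega] exceeds [1 / (k + 1)]. *)
Lemma open_exhaustion Omega : open Omega -> exists D : (set 'rV[R]_n)^nat,
  [/\ forall k, open (D k), forall k, compactly_inside Omega (D k) &
      \bigcup_k D k = Omega].
Proof.
move=> oO.
pose D (k : nat) := [set x : 'rV[R]_n | `|x| < k%:R /\
  exists2 r, k.+1%:R^-1 < r & ball x r `<=` Omega].
exists D; split=> [k|k|].
- rewrite openE => x [xk [r rk rO]]; apply/nbhs_ballP.
  pose e := Num.min (k%:R - `|x|) ((r - k.+1%:R^-1) / 2).
  have e0 : 0 < e by rewrite lt_min subr_gt0 xk divr_gt0// subr_gt0.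
  exists e => //= y; rewrite -ball_normE /= => xy; split.
    have : `|x - y| < k%:R - `|x| by apply: lt_le_trans xy _; rewrite ge_min lexx.
    rewrite distrC => h; rewrite -(subrK x y).
    by apply: le_lt_trans (ler_normD _ _) _; rewrite -ltrBrDr.
  have yr : `|x - y| < (r - k.+1%:R^-1) / 2.
    by apply: lt_le_trans xy _; rewrite ge_min lexx orbT.
  have mid (a b : R) : a < b -> a < b - (b - a) / 2 by lra.
  have rest (a b s t : R) : s < (b - a) / 2 -> t < b - (b - a) / 2 -> s + t < b.
    by lra.
  exists (r - (r - k.+1%:R^-1) / 2); first exact: mid.
  move=> z; rewrite -ball_normE /= => yz; apply: rO; rewrite -ball_normE /=.
  rewrite -(subrKA y); apply: le_lt_trans (ler_normD _ _) _; exact: rest yr yz.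
- exists (closure (D k)); split; [|exact: subset_closure|].
    apply: bounded_closed_compact; last exact: closed_closure.
    exists k%:R; split; first exact: num_real.
    move=> M kM x; rewrite closureEcvg => -[F PF [Fx FD]]; apply: ltW.
    suff : closure [set y : 'rV[R]_n | `|y| <= k%:R] x.
      rewrite (_ : closure _ = [set y : 'rV[R]_n | `|y| <= k%:R]).
        by move=> /=; move/le_lt_trans; exact.
      apply/esym/closure_id.
      by apply: (closed_comp _ (@closed_le _ k%:R)) => y _; exact: norm_continuous.
    have : closure (D k) x by rewrite closureEcvg; exists F.
    by apply: closure_subset => y [/ltW].
  move=> x /(_ (ball x k.+1%:R^-1)) [|y [[_ [r rk rO]] xy]].
    by apply/nbhs_ballP; exists k.+1%:R^-1 => //=; rewrite invr_gt0.
  by apply: rO; apply: ball_sym; exact: le_ball (ltW rk) _ xy.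
- apply/seteqP; split=> [x [k _ [_ [r rk]]]|x Ox].
    by apply; apply: ballxx; apply: lt_trans rk; rewrite invr_gt0.
  have /nbhs_ballP[e /= e0 xeO] : nbhs x Omega by exact: open_nbhs_nbhs.
  pose N := maxn (Num.truncn `|x|).+1 (Num.truncn e^-1).+1.
  exists N => //; split.
    apply: lt_le_trans (truncnS_gt _) _; rewrite ler_nat leq_maxl//.
  exists e => //; rewrite invf_plt ?posrE//.
  by apply: lt_le_trans (truncnS_gt _) _; rewrite ler_nat leqW// leq_maxr.
Qed.

End compactly_inside.

Lemma closed_measurable_rV {R : realType} n (A : set 'rV[R]_n) :
  closed A -> measurable A.
Proof.
move=> cA; rewrite -(setCK A); apply: measurableC; apply: open_measurable_rV.
exact: closed_openC.
Qed.

Lemma measurable_box_rV {R : realType} n (a b : 'I_n -> R) :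
  measurable [set x : 'rV[R]_n | forall i, a i < x ord0 i <= b i].
Proof.
rewrite (_ : mkset _ = \bigcap_(i in [set: 'I_n]) ((fun x : 'rV[R]_n => x ord0 i)
    @^-1` `]a i, b i]%classic)); last first.
  by apply/seteqP; split=> [x H i _|x H i]; [rewrite /= in_itv; exact: H|
    have := H i I; rewrite /= in_itv].
apply: fin_bigcap_measurable => // i _; rewrite -[X in measurable X]setTI.
exact: measurable_coord.
Qed.

Section measure_construction.
Context {d : measure_display} {T : measurableType d} {R : realType}.
Local Open Scope ereal_scope.

(** The total variation is only meaningful on Borel sets, whereas a measure
    has to be nonnegative on every set: the values on the other sets are
    replaced by [0]. *)
Lemma measure_of_set_function (f : set T -> \bar R) : f set0 = 0 ->
  (forall A, measurable A -> 0 <= f A) ->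
  semi_sigma_additive f ->
  exists m : {measure set T -> \bar R}, forall A, measurable A -> m A = f A.
Proof.
move=> f0 fge0 fsa; pose g A := if `[< measurable A >] then f A else 0.
have gE A : measurable A -> g A = f A by move=> mA; rewrite /g asboolT.
have g0 : g set0 = 0 by rewrite gE.
have gge0 A : 0 <= g A.
  by rewrite /g; case: ifPn => // /asboolP; exact: fge0.
have gsa : semi_sigma_additive g.
  move=> F mF tF mUF; rewrite gE//.
  under eq_fun do (under eq_bigr do rewrite gE//).
  exact: fsa.
pose m := isMeasure.Build _ _ _ g g0 gge0 gsa.
by exists (HB.pack_for {measure set T -> \bar R} g m) => A mA /=; exact: gE.
Qed.

End measure_construction.

(** * The total variation is a measure *)
Section variation.
Context {R : realType} {n : nat} {W : vectType R} (dW : {dot W for idfun}).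
Variables (Omega : set 'rV[R]_n) (mu : set 'rV[R]_n -> W).
Hypothesis oO : open Omega.
Hypothesis muP : locally_bounded_measure dW Omega mu.
Local Notation nu := (variation_measure dW Omega mu).
Local Notation M A := (dnorm dW (mu A)).

Lemma dot_mu_sigma_additive A F w : compactly_inside Omega A ->
  countable_partition Omega A F ->
  \sum_(k < N) dW (mu (F k)) w @[N --> \oo] --> dW (mu A) w.
Proof.
move=> ciA pF; have [sa _] := muP; have h := sa _ _ ciA pF.
apply/subr_cvg0; apply/cvgr0Pnorm_le => e e0.
have w1 : 0 < dnorm dW w + 1 by rewrite ltr_wpDl// dnorm_ge0.
move/cvgr0Pnorm_le : h => /(_ (e / (dnorm dW w + 1)) (divr_gt0 e0 w1)).
apply: filterS => N; rewrite ger0_norm ?dnorm_ge0// => hN.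
rewrite -dot_suml -dotNl -dotDl (le_trans (cauchy_schwarz _ _ _))//.
rewrite -[leRHS](@mulfVK _ (dnorm dW w + 1)) ?gt_eqF//.
by rewrite ler_pM ?dnorm_ge0// lerDl.
Qed.

(** The constant sequence of empty sets is a partition of the empty set, so the
    multiples of [mu set0] converge. *)
Lemma mu_set0 : mu set0 = 0.
Proof.
have ci0 : compactly_inside Omega set0.
  by exists set0; split; [exact: compact0| |].
have p0 : countable_partition Omega set0 (fun=> set0).
  by split=> //; [exact: trivIset_set0|rewrite bigcup0].
have h := dot_mu_sigma_additive (w := mu set0) ci0 p0.
have h' : \sum_(k < N.+1) dW (mu set0) (mu set0) @[N --> \oo] -->
    dW (mu set0) (mu set0).
  by rewrite (cvg_shiftS (fun N => \sum_(k < N) dW (mu set0) (mu set0))).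
have h2 : \sum_(k < N.+1) dW (mu set0) (mu set0) @[N --> \oo] -->
    dW (mu set0) (mu set0) + dW (mu set0) (mu set0).
  under eq_fun do rewrite big_ord_recr/=.
  by apply: cvgD => //; exact: cvg_cst.
have := cvg_lim (@Rhausdorff R) h2; rewrite (cvg_lim (@Rhausdorff R) h') => m0.
have {}m0 : dW (mu set0) (mu set0) = 0.
  by apply: (addrI (dW (mu set0) (mu set0))); rewrite addr0 -m0.
by apply: (@dnorm0_eq0 _ _ dW); rewrite /dnorm m0 sqrtr0.
Qed.

Lemma countable_partition_bigcup2 A B : measurable A -> measurable B ->
  A `&` B = set0 -> compactly_inside Omega (A `|` B) ->
  countable_partition Omega (A `|` B) (bigcup2 A B).
Proof.
move=> mA mB AB0 ci; split.
- by case=> [|[|k]]; rewrite /bigcup2/=; [exact: mA|exact: mB|exact: measurable0].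
- have c0 : compactly_inside Omega (set0 : set 'rV[R]_n).
    by apply: compactly_insideS ci; exact: sub0set.
  by case=> [|[|k]] //=; apply: compactly_insideS ci => x; [left|right].
- by rewrite -trivIset_bigcup2.
- exact: bigcup2E.
Qed.

Lemma norm_mu_subadditive A F : compactly_inside Omega A ->
  countable_partition Omega A F ->
  ((M A)%:E <= \sum_(k <oo) (M (F k))%:E)%E.
Proof.
move=> ciA pF; have [sa _] := muP; have h := sa _ _ ciA pF.
apply/lee_addgt0Pr => e e0.
move/cvgr0Pnorm_le : h => /(_ _ e0)[N _ /(_ N (leqnn N))/=].
rewrite ger0_norm ?dnorm_ge0// => hN.
have : M A <= \sum_(k < N) M (F k) + e.
  rewrite -lerBlDl (le_trans _ hN)// -[leRHS]dnormN opprB.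
  apply: le_trans (_ : M A - dnorm dW (\sum_(k < N) mu (F k)) <= _).
    by rewrite lerB// ler_dnorm_sum.
  by rewrite (le_trans (ler_norm _))// ler_dnormB.
rewrite -lee_fin EFinD => /le_trans; apply; rewrite leeD2r//.
rewrite -sumEFin -(big_mkord xpredT (fun k => (M (F k))%:E)).
by apply: nneseries_lim_ge => k _; rewrite lee_fin dnorm_ge0.
Qed.

Lemma countable_partition_setI A F B : countable_partition Omega A F ->
  measurable B -> countable_partition Omega (A `&` B) (fun k => F k `&` B).
Proof.
move=> [mF cF tF <-] mB; split.
- by move=> k; exact: measurableI.
- by move=> k; apply: compactly_insideS (cF k) => x [].
- exact: trivIset_setIr.
- by rewrite setI_bigcupl.
Qed.

Lemma exists_countable_partition A : measurable A ->
  exists F, countable_partition Omega (A `&` Omega) F.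
Proof.
move=> mA; have [D [oD cD UD]] := open_exhaustion oO.
exists (fun k => seqDU D k `&` A); rewrite setIC.
apply: countable_partition_setI => //; split.
- move=> k; apply: measurableD; first exact: open_measurable_rV.
  by apply: bigsetU_measurable => i _; exact: open_measurable_rV.
- by move=> k; apply: compactly_insideS (cD k); exact: subDsetl.
- exact: trivIset_seqDU.
- by rewrite -seqDU_bigcup_eq.
Qed.

Lemma le_variation A F : countable_partition Omega (A `&` Omega) F ->
  (\sum_(k <oo) (M (F k))%:E <= nu A)%E.
Proof. by move=> pF; apply: ereal_sup_ubound; exists F. Qed.

Lemma variation_ge0 A : measurable A -> (0 <= nu A)%E.
Proof.
move=> /exists_countable_partition[F pF]; apply: le_trans (le_variation pF).
by apply: nneseries_ge0 => k _ _; rewrite lee_fin dnorm_ge0.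
Qed.

Lemma variation_set0 : nu set0 = 0%E.
Proof.
apply/eqP; rewrite eq_le variation_ge0// andbT.
apply: ge_ereal_sup => _ [F [_ _ _ UF] <-].
rewrite eseries0// => k _ _; suff -> : F k = set0 by rewrite mu_set0 dnorm0.
by apply/seteqP; split=> // x Fkx; move: UF; rewrite set0I => <-; exists k.
Qed.

Lemma le_norm_variation A : measurable A -> compactly_inside Omega A ->
  ((M A)%:E <= nu A)%E.
Proof.
move=> mA cA.
have A0 : A `|` set0 = A by rewrite setU0.
have pA : countable_partition Omega (A `&` Omega) (bigcup2 A set0).
  have -> : A `&` Omega = A `|` set0.
    by rewrite A0 setIidl//; case: cA => K [_ AK KO]; exact: subset_trans KO.
  by apply: countable_partition_bigcup2 => //; rewrite ?setI0// A0.
apply: le_trans (le_variation pA).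
have := @nneseries_lim_ge R (fun k => (M (bigcup2 A set0 k))%:E) xpredT 0 1.
rewrite big_nat1; apply => k _; by rewrite lee_fin dnorm_ge0.
Qed.

(** A partition of the union is refined by intersecting it with the [F i]; the
    triangle inequality for the countably additive [mu] only increases the sum. *)
Lemma variation_sigma_subadditive A (F : (set 'rV[R]_n)^nat) :
  (forall k, measurable (F k)) -> trivIset setT F -> A = \bigcup_k F k ->
  (nu A <= \sum_(k <oo) nu (F k))%E.
Proof.
move=> mF tF AF; apply: ge_ereal_sup => _ [G pG <-].
have [mG cG tG UG] := pG.
apply: (@le_trans _ _
    (\sum_(k <oo) \sum_(i <oo) (M (G k `&` F i))%:E)%E).
  apply: lee_nneseries => k _; first by rewrite lee_fin dnorm_ge0.
  apply: norm_mu_subadditive => //; split.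
  - by move=> i; exact: measurableI.
  - by move=> i; apply: compactly_insideS (cG k) => x [].
  - exact: trivIset_setIl.
  - rewrite -setI_bigcupr -AF setIidl// => x Gx.
    by have [] : (A `&` Omega) x by rewrite -UG; exists k.
rewrite nneseries_interchange; last by move=> *; rewrite lee_fin dnorm_ge0.
apply: lee_nneseries => i _.
  by move=> *; apply: nneseries_ge0 => *; rewrite lee_fin dnorm_ge0.
apply: (@le_variation (F i) (fun k => G k `&` F i)).
have -> : F i `&` Omega = (A `&` Omega) `&` F i.
  by apply/seteqP; split=> [x [Fx Ox]|x [[Ax Ox] Fx]]//; split=> //; split=> //;
    rewrite AF; exists i.
exact: countable_partition_setI.
Qed.

(** Interleaving a partition of [A] with one of [B] gives a partition of
    [A `|` B]. *)
Lemma variation_superadditive2 A B : measurable A -> measurable B ->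
  A `&` B = set0 -> (nu A + nu B <= nu (A `|` B))%E.
Proof.
move=> mA mB AB0.
have key F G : countable_partition Omega (A `&` Omega) F ->
    countable_partition Omega (B `&` Omega) G ->
    (\sum_(k <oo) (M (F k))%:E + \sum_(k <oo) (M (G k))%:E <= nu (A `|` B))%E.
  move=> [mF cF tF UF] [mG cG tG UG].
  pose H k := if odd k then G k./2 else F k./2.
  have pH : countable_partition Omega ((A `|` B) `&` Omega) H.
    split.
    - by move=> k; rewrite /H; case: ifP.
    - by move=> k; rewrite /H; case: ifP.
    - have FG i j x : F i x -> G j x -> False.
        move=> Fx Gx; suff : (A `&` B) x by rewrite AB0.
        have [] : (A `&` Omega) x by rewrite -UF; exists i.
        by have [] : (B `&` Omega) x by rewrite -UG; exists j.
      have eqh i j : odd i = odd j -> i./2 = j./2 -> i = j.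
        by move=> e h; rewrite -(odd_double_half i) -(odd_double_half j) e h.
      move=> i j _ _ [x []]; rewrite /H; case Ei: (odd i); case Ej: (odd j) => Hi Hj.
      + by apply: eqh; [rewrite Ei Ej|apply: tG => //; exists x].
      + by case: (FG _ _ _ Hj Hi).
      + by case: (FG _ _ _ Hi Hj).
      + by apply: eqh; [rewrite Ei Ej|apply: tF => //; exists x].
    - rewrite setIUl -UF -UG; apply/seteqP; split=> [x [k _]|x [[k _ kx]|[k _ kx]]].
      + by rewrite /H; case: ifP => _ kx; [right|left]; exists k./2.
      + by exists k.*2 => //; rewrite /H odd_double doubleK.
      + by exists k.*2.+1 => //; rewrite /H /= odd_double/= uphalf_double.
  apply: le_trans (le_variation pH).
  have ge0 (E : nat -> set 'rV[R]_n) N k : (N <= k)%N -> true -> (0 <= (M (E k))%:E)%E.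
    by move=> _ _; rewrite lee_fin dnorm_ge0.
  rewrite -nneseriesD//; [|exact: ge0|exact: ge0].
  apply: lime_le; first by apply: is_cvg_nneseries => k _ _; rewrite adde_ge0// lee_fin dnorm_ge0.
  apply: nearW => N.
  apply: (@le_trans _ _ (\sum_(0 <= k < N.*2) (M (H k))%:E)%E).
    rewrite le_eqVlt; apply/orP; left; apply/eqP.
    elim: N => [|N IH]; first by rewrite !big_nil.
    rewrite doubleS 3?big_nat_recr//= IH -addeA /H /= odd_double/= doubleK.
    by rewrite uphalf_double.
  by apply: nneseries_lim_ge => k _; rewrite lee_fin dnorm_ge0.
have nuA := variation_ge0 mA; have nuB := variation_ge0 mB.
(* Suprema over the two partitions are taken one after the other, which
   requires subtracting finite quantities. *)
have [Cfin|] := boolP (nu (A `|` B) \is a fin_num); last first.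
  rewrite ge0_fin_numE ?variation_ge0//; last exact: measurableU.
  by rewrite -leNgt leye_eq => /eqP ->; rewrite leey.
have h1 G : countable_partition Omega (B `&` Omega) G ->
    (nu A + \sum_(k <oo) (M (G k))%:E <= nu (A `|` B))%E.
  move=> pG; have Gfin : (\sum_(k <oo) (M (G k))%:E)%E \is a fin_num.
    rewrite ge0_fin_numE; last by apply: nneseries_ge0 => *; rewrite lee_fin dnorm_ge0.
    have [F pF] := exists_countable_partition mA.
    apply: le_lt_trans (_ : (_ <= nu (A `|` B))%E) _; last first.
      by rewrite -ge0_fin_numE//; apply: variation_ge0; exact: measurableU.
    apply: le_trans (key _ _ pF pG); rewrite leeDr//.
    by apply: nneseries_ge0 => *; rewrite lee_fin dnorm_ge0.
  rewrite -leeBrDr//; apply: ge_ereal_sup => _ [F pF <-].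
  by rewrite leeBrDr//; exact: key.
have Afin : nu A \is a fin_num.
  have [G pG] := exists_countable_partition mB.
  rewrite ge0_fin_numE//; apply: le_lt_trans (_ : (_ <= nu (A `|` B))%E) _; last first.
    by rewrite -ge0_fin_numE//; apply: variation_ge0; exact: measurableU.
  apply: le_trans (h1 _ pG); rewrite leeDl//.
  by apply: nneseries_ge0 => *; rewrite lee_fin dnorm_ge0.
rewrite -leeBrDl//; apply: ge_ereal_sup => _ [G pG <-].
by rewrite leeBrDl//; exact: h1.
Qed.

Lemma le_variation_set A B : measurable A -> measurable B -> A `<=` B ->
  (nu A <= nu B)%E.
Proof.
move=> mA mB AB; rewrite -(setUIDK B A) (setIidr AB).
have mBA := measurableD mB mA.
apply: le_trans (variation_superadditive2 mA mBA _); last first.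
  by rewrite setDE setICA setICr setI0.
by rewrite leeDl// variation_ge0.
Qed.

Lemma variation_sigma_additive : semi_sigma_additive nu.
Proof.
move=> F mF tF mUF.
have nu0 k : (0 <= nu (F k))%E by exact: variation_ge0.
have -> : nu (\bigcup_k F k) = (\sum_(k <oo) nu (F k))%E; last first.
  exact: is_cvg_nneseries.
apply/eqP; rewrite eq_le variation_sigma_subadditive//=.
apply: lime_le; first exact: is_cvg_nneseries.
apply: nearW => N; apply: (@le_trans _ _ (nu (\big[setU/set0]_(k < N) F k))); last first.
  apply: le_variation_set => //; first by apply: bigsetU_measurable.
  by exact: bigsetU_bigcup.
elim: N => [|N IH]; first by rewrite big_nil big_ord0 variation_set0.
rewrite big_nat_recr//= big_ord_recr/=.
apply: le_trans (variation_superadditive2 _ _ _) => //.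
- by rewrite leeD2r.
- exact: bigsetU_measurable.
- by apply: (@trivIset_bigsetUI _ xpredT) => //; apply: sub_trivIset tF => ?.
Qed.

Lemma variation_compactly_inside_lty A : measurable A ->
  compactly_inside Omega A -> (nu A < +oo)%E.
Proof.
move=> mA [K [cK AK KO]]; have [_ /(_ _ cK KO)] := muP.
apply: le_lt_trans; apply: le_variation_set => //.
apply: closed_measurable_rV; exact: compact_closed.
Qed.

Lemma exists_variation_measure : exists s : {measure set 'rV[R]_n -> \bar R},
  forall A, measurable A -> s A = nu A.
Proof.
apply: measure_of_set_function; [exact: variation_set0|exact: variation_ge0|].
exact: variation_sigma_additive.
Qed.

End variation.

(** * Outer regularity of finite Borel measures *)
Section outer_regularity.
Context {R : realType} {n : nat} (m : {measure set 'rV[R]_n -> \bar R}).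
Hypothesis mT : (m setT < +oo)%E.
Local Open Scope ereal_scope.

Let mfin A : measurable A -> m A < +oo.
Proof.
move=> mA; apply: le_lt_trans mT.
exact: le_measure (mem_set mA) (mem_set measurableT) _.
Qed.

(** The finite unions of the [K k] exhaust the whole union, and a finite measure
    is continuous from above. *)
Let inner_approximation (U : set 'rV[R]_n) (K : (set 'rV[R]_n)^nat) (e : R) :
  (0 < e)%R -> measurable U -> (forall k, closed (K k)) ->
  m (U `\` \bigcup_k K k) <= (e / 2)%:E ->
  exists N, m (U `\` \big[setU/set0]_(k < N) K k) <= e%:E.
Proof.
move=> e0 mU cK mUK.
have mK k : measurable (K k) by exact: closed_measurable_rV.
pose D N := U `\` \big[setU/set0]_(k < N) K k.
have mD N : measurable (D N).
  by apply: measurableD => //; exact: bigsetU_measurable.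
have capD : \bigcap_N D N = U `\` \bigcup_k K k.
  apply/seteqP; split=> [x Dx|x [Ux nK] N _].
    split; first by have [] := Dx 0%N I.
    by move=> [k _ Kx]; have [_] := Dx k.+1 I; apply; rewrite big_ord_recr; right.
  by split=> // Kx; apply: nK; move: Kx; apply: bigsetU_bigcup.
have dD : nonincreasing_seq D.
  move=> i j ij; apply/subsetPset; apply: setDS; exact: subset_bigsetU.
have mcap : measurable (\bigcap_N D N) by exact: bigcap_measurable.
have := nonincreasing_cvg_mu (mfin (mD 0%N)) mD mcap dD.
rewrite capD => cv.
have lt : m (U `\` \bigcup_k K k) < e%:E.
  by apply: le_lt_trans mUK _; rewrite lte_fin ltr_pdivrMr// ltr_pMr// ltr1n.
have : \forall N \near \oo, (m \o D) N < e%:E by exact: (cv _ (open_ereal_lt' lt)).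
by move=> [N _ /(_ N (leqnn N)) /ltW]; exists N.
Qed.

(** Asking for a closed set inside together with an open set outside makes the
    property invariant under complements. *)
Let approximable (A : set 'rV[R]_n) := forall e : R, (0 < e)%R ->
  exists K U : set 'rV[R]_n, [/\ closed K, open U, K `<=` A, A `<=` U & m (U `\` K) <= e%:E].

Let open_approximable (U : set 'rV[R]_n) : open U -> approximable U.
Proof.
move=> oU e e0; have [D [oD cD UD]] := open_exhaustion oU.
pose K k := sval (cid (cD k)).
have PK k : [/\ compact (K k), D k `<=` K k & K k `<=` U] by exact: svalP (cid (cD k)).
have cK k : closed (K k) by apply: compact_closed; [exact: norm_hausdorff|case: (PK k)].
have [|N hN] := @inner_approximation U K e e0 (open_measurable_rV oU) cK.
  rewrite (_ : _ `\` _ = set0) ?measure0 ?lee_fin ?divr_ge0 ?ltW//.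
  apply/seteqP; split=> // x [Ux]; apply.
  by move: Ux; rewrite -UD => -[k _ Dx]; exists k => //; have [_ + _] := PK k; apply.
exists (\big[setU/set0]_(k < N) K k), U; split => //.
- by apply: closed_bigsetU => i _; exact: cK.
- by rewrite -bigcup_mkord => x [k _]; have [_ _] := PK k; apply.
Qed.

Let approximable_sigma_algebra : sigma_algebra setT [set A | measurable A /\ approximable A].
Proof.
split => /=.
- split=> // e e0; exists set0, set0; split=> //.
  + exact: closed0.
  + by rewrite setD0 measure0 lee_fin ltW.
- move=> A [mA aA]; split; first by rewrite setTD; exact: measurableC.
  move=> e e0; have [K [U [cK oU KA AU h]]] := aA e e0.
  exists (~` U), (~` K); rewrite setTD; split.
  + exact: open_closedC.
  + exact: closed_openC.
  + exact: subsetC.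
  + exact: subsetC.
  + by rewrite setDE setCK setIC -setDE.
- move=> F hF; split; first by apply: bigcup_measurable => k _; have [] := hF k.
  move=> e e0.
  pose ek k : R := (e / 2 / (2 ^ k.+1)%:R)%R.
  have ek0 k : (0 < ek k)%R by rewrite !divr_gt0// ltr0n expn_gt0.
  have aF k : exists KU : set 'rV[R]_n * set 'rV[R]_n,
      [/\ closed KU.1, open KU.2, KU.1 `<=` F k, F k `<=` KU.2 &
          m (KU.2 `\` KU.1) <= (ek k)%:E].
    by have [_ /(_ _ (ek0 k))[K [U ?]]] := hF k; exists (K, U).
  have [KU hKU] := choice aF.
  pose U := \bigcup_k (KU k).2.
  have oU : open U by apply: bigcup_open => k _; have [] := hKU k.
  have cK k : closed (KU k).1 by have [] := hKU k.
  have mKU k : measurable ((KU k).2 `\` (KU k).1).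
    by have [? ? _ _ _] := hKU k; apply: measurableD; [exact: open_measurable_rV|
      exact: closed_measurable_rV].
  have [|N hN] := @inner_approximation U (fun k => (KU k).1) e e0 (open_measurable_rV oU) cK.
    have mUK : measurable (U `\` \bigcup_k (KU k).1).
      apply: measurableD; first exact: open_measurable_rV.
      by apply: bigcup_measurable => k _; exact: closed_measurable_rV.
    apply: (@le_trans _ _ (\sum_(k <oo) m ((KU k).2 `\` (KU k).1))).
      apply: measure_sigma_subadditive => // x [[k _ kx] nx].
      by exists k => //; split=> // kx'; apply: nx; exists k.
    apply: le_trans (epsilon_trick0 xpredT _); last by rewrite divr_ge0// ltW.
    by apply: lee_nneseries => // k _; have [] := hKU k.
  exists (\big[setU/set0]_(k < N) (KU k).1), U; split => //.
  + by apply: closed_bigsetU => i _; exact: cK.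
  + rewrite -(bigcup_mkord N (fun k => (KU k).1)) => x [k _ kx].
    by exists k => //; have [_ _ + _ _] := hKU k; apply.
  + by move=> x [k _ kx]; exists k => //; have [_ _ _ + _] := hKU k; apply.
Qed.

Lemma outer_regularity (A : set 'rV[R]_n) (e : R) : measurable A -> (0 < e)%R ->
  exists U : set 'rV[R]_n, [/\ open U, A `<=` U & m (U `\` A) <= e%:E].
Proof.
move=> mA e0.
have openP : @open 'rV[R]_n `<=` [set A | measurable A /\ approximable A].
  by move=> U oU; split; [exact: open_measurable_rV|exact: open_approximable].
have [_ /(_ _ e0)[K [U [cK oU KA AU h]]]] :=
  smallest_sub approximable_sigma_algebra openP mA.
exists U; split => //; apply: le_trans h.
apply: le_measure; rewrite ?inE.
- by apply: measurableD => //; exact: open_measurable_rV.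
- by apply: measurableD; [exact: open_measurable_rV|exact: closed_measurable_rV].
- exact: setDS.
Qed.

End outer_regularity.

(** * Covering by dyadic cubes *)
Section dyadic.
Context {R : realType} {n : nat}.
Implicit Types (x y : 'rV[R]_n) (z : {ffun 'I_n -> int}) (k : nat).

Definition dyadic_index k x : {ffun 'I_n -> int} :=
  [ffun i => Num.floor (2 ^+ k * x ord0 i)].

Definition dyadic_cell k z : set 'rV[R]_n := [set x | dyadic_index k x = z].

(** The cube [dyadic_cell k z] together with the adjacent ones: it contains
    every ball of radius at most [2 ^- k] centred in the middle cube. *)
Definition dyadic_neighbourhood k z : set 'rV[R]_n :=
  [set x | forall i, `|dyadic_index k x i - z i| <= 1].

Definition dyadic_parent z : {ffun 'I_n -> int} := [ffun i => (z i %/ 2)%Z].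

Definition dyadic_shift z (e : {ffun 'I_n -> 'I_3}) : {ffun 'I_n -> int} :=
  [ffun i => z i + (e i : nat)%:Z - 1].

Lemma dyadic_index_parent k x :
  dyadic_index k x = dyadic_parent (dyadic_index k.+1 x).
Proof.
apply/ffunP => i; rewrite !ffunE; set y := 2 ^+ k * x ord0 i.
have -> : 2 ^+ k.+1 * x ord0 i = 2 * y by rewrite exprS mulrA.
apply: floor_def.
have /andP[h1 h2] := real_floor_itv (num_real (2 * y)).
set a := Num.floor (2 * y) in h1 h2 *; set q := (a %/ 2)%Z.
have q1 : 2 * q <= a by rewrite /q; lia.
have q2 : a + 1 <= 2 * (q + 1) by rewrite /q; lia.
move: q1 q2; rewrite -!(ler_int R) !intrM !intrD => q1 q2.
by apply/andP; split; lra.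
Qed.

Lemma dyadic_index_iter k j x :
  dyadic_index k x = iter j dyadic_parent (dyadic_index (k + j) x).
Proof.
elim: j k => [|j IH] k; first by rewrite addn0.
by rewrite dyadic_index_parent (IH k.+1) addSnnS.
Qed.

Lemma dyadic_neighbourhood_parent k z :
  dyadic_neighbourhood k.+1 z `<=` dyadic_neighbourhood k (dyadic_parent z).
Proof.
move=> x h i; rewrite dyadic_index_parent !ffunE; have := h i.
by rewrite ffunE; set a := Num.floor _; lia.
Qed.

Lemma dyadic_neighbourhood_iter k j z :
  dyadic_neighbourhood (k + j) z `<=` dyadic_neighbourhood k (iter j dyadic_parent z).
Proof.
elim: j k z => [|j IH] k z; first by rewrite addn0.
rewrite -addSnnS => x /IH /dyadic_neighbourhood_parent; exact.
Qed.

Lemma dyadic_neighbourhood_cells k z :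
  dyadic_neighbourhood k z = \bigcup_(e in [set: {ffun 'I_n -> 'I_3}])
    dyadic_cell k (dyadic_shift z e).
Proof.
apply/seteqP; split=> [x h|x [e _ /=] h i]; last first.
  rewrite h ffunE; have := ltn_ord (e i); lia.
have e0 i : exists e : 'I_3, dyadic_index k x i = z i + (e : nat)%:Z - 1.
  have := h i; set a := dyadic_index k x i => ha.
  have lt3 : (absz (a - z i + 1)%R < 3)%N by lia.
  by exists (Ordinal lt3) => /=; lia.
have [e he] := choice e0.
by exists [ffun i => e i] => //; apply/ffunP => i; rewrite he !ffunE.
Qed.

Lemma sub_dyadic_cell_neighbourhood k z : dyadic_cell k z `<=` dyadic_neighbourhood k z.
Proof. by move=> x <- i; rewrite subrr normr0. Qed.

Lemma measurable_dyadic_cell k z : measurable (dyadic_cell k z).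
Proof.
rewrite (_ : dyadic_cell k z = \bigcap_(i in [set: 'I_n])
  ((fun x : 'rV[R]_n => x ord0 i) @^-1`
     `[2 ^- k * (z i)%:~R, 2 ^- k * (z i + 1)%:~R[%classic)).
  apply: fin_bigcap_measurable => // i _; rewrite -[X in measurable X]setTI.
  by apply: measurable_coord.
have k0 : 0 < 2 ^+ k :> R by rewrite exprn_gt0.
have E x i : ((2 ^- k * (z i)%:~R <= x ord0 i < 2 ^- k * (z i + 1)%:~R) =
   (Num.floor (2 ^+ k * x ord0 i) == z i))%R.
  rewrite real_floor_eq ?num_real// mulrC ler_pdivrMr// mulrC.
  by rewrite [2 ^- k * _]mulrC ltr_pdivlMr// (mulrC (x ord0 i)).
apply/seteqP; split=> [x zx i _ /=|x h].
  by rewrite in_itv/= E -zx ffunE.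
by apply/ffunP => i; have := h i I; rewrite /= in_itv/= E ffunE => /eqP.
Qed.

Lemma measurable_dyadic_neighbourhood k z : measurable (dyadic_neighbourhood k z).
Proof.
rewrite dyadic_neighbourhood_cells; apply: fin_bigcup_measurable => // e _.
exact: measurable_dyadic_cell.
Qed.

Lemma ball_rVP x y (r : R) : 0 < r ->
  ball x r y <-> forall i, `|x ord0 i - y ord0 i| < r.
Proof.
move=> r0; split=> [[_ h] i|h]; first exact: (h ord0 i).
by split => // i j; rewrite ord1; exact: h.
Qed.

Lemma norm_coord_le_norm x i : `|x ord0 i| <= `|x|.
Proof.
by rewrite [leRHS]/Num.Def.normr /= mx_normrE;
  apply: (le_bigmax _ (fun j => `|x j.1 j.2|) (ord0, i)).
Qed.

Lemma floor_dist (a b : R) : `|a - b| < 1 -> `|Num.floor a - Num.floor b| <= 1.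
Proof.
move=> ab; have /andP[a1 a2] := real_floor_itv (num_real a).
have /andP[b1 b2] := real_floor_itv (num_real b).
move: ab; rewrite ltr_norml => /andP[ab1 ab2].
set p := Num.floor a in a1 a2 *; set q := Num.floor b in b1 b2 *.
have h1 : p < q + 2 by rewrite -(ltr_int R) !intrD; move: a2 b2; rewrite !intrD; lra.
have h2 : q < p + 2 by rewrite -(ltr_int R) !intrD; move: a2 b2; rewrite !intrD; lra.
by lia.
Qed.

Lemma dist_floor (a b : R) j :
  `|Num.floor a - Num.floor b| <= j -> `|a - b| < (j + 1)%:~R.
Proof.
move=> ab; have /andP[a1 a2] := real_floor_itv (num_real a).
have /andP[b1 b2] := real_floor_itv (num_real b).
set p := Num.floor a in a1 a2 ab; set q := Num.floor b in b1 b2 ab.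
have h1 : p <= q + j by lia.
have h2 : q <= p + j by lia.
move: a2 b2 h1 h2; rewrite -!(ler_int R) !intrD => a2 b2 h1 h2.
by rewrite ltr_norml; apply/andP; split; lra.
Qed.

Lemma sub_ball_dyadic_neighbourhood k x (r : R) : 0 < r -> 2 ^+ k * r <= 1 ->
  ball x r `<=` dyadic_neighbourhood k (dyadic_index k x).
Proof.
move=> r0 kr y /(ball_rVP _ _ r0) xy i; rewrite !ffunE; apply: floor_dist.
have k0 : 0 < 2 ^+ k :> R by rewrite exprn_gt0.
rewrite -mulrBr normrM gtr0_norm//; apply: lt_le_trans kr.
by rewrite ltr_pM2l// distrC.
Qed.

Lemma sub_dyadic_neighbourhood_ball k z x (r : R) : 0 < r -> 3 <= 2 ^+ k * r ->
  dyadic_neighbourhood k z x -> dyadic_neighbourhood k z `<=` ball x r.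
Proof.
move=> r0 kr zx y zy; apply/(ball_rVP _ _ r0) => i.
have k0 : 0 < 2 ^+ k :> R by rewrite exprn_gt0.
rewrite -(ltr_pM2l k0); apply: lt_le_trans kr.
rewrite -[X in X * _](gtr0_norm k0) -normrM mulrBr.
rewrite (_ : 3 = (2 + 1)%:~R)//; apply: dist_floor.
have := zx i; have := zy i; rewrite !ffunE.
by move: (Num.floor _) (Num.floor _) => a b; lia.
Qed.

(** The side [2 ^- k] is comparable with [r], between [r] and [2 * r]. *)
Lemma dyadic_scale (r : R) : 0 < r -> r < 1 ->
  exists k, 2 ^+ k * r <= 1 /\ 1 < 2 ^+ k * (2 * r).
Proof.
move=> r0 r1.
have ex : exists k, 1 < 2 ^+ k * (2 * r).
  exists (Num.truncn r^-1).+1.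
  rewrite -ltr_pdivrMr ?mulr_gt0// mul1r invfM.
  apply: (@lt_trans _ _ r^-1).
    by rewrite -[ltRHS]mul1r ltr_pM2r ?invr_gt0// invf_lt1// ltr1n.
  apply: lt_trans (truncnS_gt _) _.
  by rewrite -natrX ltr_nat ltn_expl.
pose k := ex_minn ex; exists k; rewrite /k; case: ex_minnP => {k} k hk mink.
split=> //; case: k hk mink => [|k] hk mink; first by rewrite expr0 mul1r ltW.
rewrite leNgt; apply/negP => h; have := mink k.
by rewrite ltnn => /(_ _)/negP; apply => //; rewrite mulrA -exprSr.
Qed.

End dyadic.

Section dyadic_covering.
Context {R : realType} {n : nat}.
Variables s rho : {measure set 'rV[R]_n -> \bar R}.
Local Open Scope ereal_scope.

(** The cubes of [G] without a strictly larger cube of [G] above them are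
    disjoint, because two dyadic cubes are nested or disjoint. They suffice to
    cover, because neighbourhoods grow with the cube. *)
Lemma dyadic_covering (lam : R) (G : set (nat * {ffun 'I_n -> int})) U :
  (0 <= lam)%R -> measurable U ->
  (forall q, G q -> dyadic_cell q.1 q.2 `<=` U /\
    lam%:E * s (dyadic_neighbourhood q.1 q.2) <= rho (dyadic_cell q.1 q.2)) ->
  exists C, [/\ measurable C,
    \bigcup_(q in G) dyadic_neighbourhood q.1 q.2 `<=` C & lam%:E * s C <= rho U].
Proof.
move=> lam0 mU hG.
pose G' := [set q | G q /\ forall j, (j < q.1)%N ->
  ~ G (j, iter (q.1 - j) (@dyadic_parent n) q.2)].
(* The maximal cubes and their neighbourhoods are enumerated by [nat], with
   empty sets at the numbers that encode no maximal cube. *)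
pose nb (m : nat) : set 'rV[R]_n := if pickle_inv m is Some q then
  if `[< G' q >] then dyadic_neighbourhood q.1 q.2 else set0 else set0.
pose ce (m : nat) : set 'rV[R]_n := if pickle_inv m is Some q then
  if `[< G' q >] then dyadic_cell q.1 q.2 else set0 else set0.
have mnb m : measurable (nb m).
  rewrite /nb; case: pickle_inv => // q; case: ifP => // _.
  exact: measurable_dyadic_neighbourhood.
have mce m : measurable (ce m).
  rewrite /ce; case: pickle_inv => // q; case: ifP => // _.
  exact: measurable_dyadic_cell.
have tce : trivIset setT ce.
  move=> i j _ _ [x []]; rewrite /ce.
  case Ei : (pickle_inv i) => [[k z]|//]; case Ej : (pickle_inv j) => [[k' z']|//].
  case: asboolP => // -[Gz mz]; case: asboolP => // -[Gz' mz'] /=.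
  rewrite /dyadic_cell/= => zE z'E.
  suff : (k, z) = (k', z').
    move=> zz'; pose T := (nat * {ffun 'I_n -> int})%type.
    have := @pickle_invK T i; have := @pickle_invK T j.
    by rewrite Ei Ej /= zz' => <- <-.
  case: (ltngtP k k') => kk'.
  - exfalso; apply: (mz' _ kk') => /=; rewrite -z'E -[in dyadic_index k'](subnKC (ltnW kk')).
    by rewrite -dyadic_index_iter zE.
  - exfalso; apply: (mz _ kk') => /=; rewrite -zE -[in dyadic_index k](subnKC (ltnW kk')).
    by rewrite -dyadic_index_iter z'E.
  - by rewrite -zE -z'E kk'.
exists (\bigcup_m nb m); split.
- exact: bigcup_measurable.
- move=> x [[k z] Gkz /= kzx].
  pose P j := `[< (j <= k)%N /\ G (j, iter (k - j) (@dyadic_parent n) z) >].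
  have exP : exists j, P j by exists k; apply/asboolP; split=> //; rewrite subnn.
  case: (ex_minnP exP) => j /asboolP[jk Gj] minj.
  exists (pickle (j, iter (k - j) (@dyadic_parent n) z)) => //.
  rewrite /nb pickleK_inv ifT; last first.
    apply/asboolP; split=> //= i ij Gi.
    have : P i.
      apply/asboolP; split; first exact: leq_trans (ltnW ij) jk.
      by move: Gi; rewrite -iterD addnBAC 1?ltnW// subnKC.
    by move/minj; rewrite leqNgt ij.
  by apply: dyadic_neighbourhood_iter; rewrite subnKC.
- apply: (@le_trans _ _ (lam%:E * \sum_(m <oo) s (nb m))).
    apply: lee_wpmul2l; first by rewrite lee_fin.
    by apply: measure_sigma_subadditive => //; exact: bigcup_measurable.
  rewrite -nneseriesZl; last by move=> *; exact: measure_ge0.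
  apply: (@le_trans _ _ (\sum_(m <oo) rho (ce m))).
    apply: lee_nneseries => [m _|m _]; first by rewrite mule_ge0 ?lee_fin.
    rewrite /nb /ce; case: pickle_inv => [q|]; last by rewrite !measure0 mule0.
    by case: asboolP => [[Gq _]|_]; [exact: (hG _ Gq).2|rewrite !measure0 mule0].
  rewrite -measure_semi_bigcup//; last exact: bigcup_measurable.
  apply: le_measure; rewrite ?inE//; first exact: bigcup_measurable.
  move=> x [m _]; rewrite /ce; case: pickle_inv => // q.
  by case: asboolP => // -[Gq _]; exact: (hG _ Gq).1.
Qed.

End dyadic_covering.

Section frequent_ball_covering.
Context {R : realType} {n : nat}.
Variables s rho : {measure set 'rV[R]_n -> \bar R}.
Hypothesis rhoT : (rho setT < +oo)%E.
Local Open Scope ereal_scope.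

Lemma measure_bigsetU_le (m : {measure set 'rV[R]_n -> \bar R}) I (r : seq I)
    (F : I -> set 'rV[R]_n) (c : \bar R) : (forall i, measurable (F i)) ->
  (forall i, m (F i) <= c) ->
  m (\big[setU/set0]_(i <- r) F i) <= (size r)%:R%:E * c.
Proof.
move=> mF Fc; elim: r => [|i r IH]; first by rewrite big_nil measure0 mul0e.
have mr : measurable (\big[setU/set0]_(j <- r) F j) by exact: bigsetU_measurable.
rewrite big_cons /= -natr1 EFinD ge0_muleDl ?lee_fin// mul1e addeC.
have := measureU2 m (mF i) mr; move=> /le_trans; apply; exact: leeD (Fc i) IH.
Qed.

(** If [rho] is large on a small ball around [x], compared with [s] on the
    sixfold ball, then one of the [3 ^ n] dyadic cubes of comparable side that
    cover the ball has a [1 / 3 ^ n] share of its mass, while its neighbourhood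
    stays inside the sixfold ball. Such cubes lie in any open [U] around [F],
    and outer regularity makes [rho U] close to [rho F]. *)
Lemma frequent_ball_covering (lam e : R) (F : set 'rV[R]_n) :
  (0 < lam)%R -> (0 < e)%R -> measurable F ->
  exists C : set 'rV[R]_n, [/\ measurable C,
    [set x | F x /\ forall d : R, (0 < d)%R -> exists r, [/\ (0 < r)%R, (r < d)%R &
      (3 ^+ n * lam)%:E * s (ball x (6 * r)%R) < rho (ball x r)]] `<=` C &
    lam%:E * s C <= rho F + e%:E].
Proof.
move=> lam0 e0 mF.
have [U [oU FU Ue]] := outer_regularity rhoT mF e0.
have mU := open_measurable_rV oU.
pose G := [set q : nat * {ffun 'I_n -> int} | dyadic_cell q.1 q.2 `<=` U /\
  lam%:E * s (dyadic_neighbourhood q.1 q.2) <= rho (dyadic_cell q.1 q.2)].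
have [|C [mC GC hC]] := @dyadic_covering R n s rho lam G U (ltW lam0) mU.
  by [].
exists C; split => //; last first.
  apply: le_trans hC _; rewrite -(setDUK FU).
  by rewrite (le_trans (measureU2 rho mF (measurableD mU mF)))// leeD2l.
move=> x [Fx hx]; apply: GC.
have /nbhs_ballP[d /= d0 dU] : nbhs x U by apply: open_nbhs_nbhs; split=> //; exact: FU.
have d60 : (0 < Num.min (d / 6) 1)%R by rewrite lt_min divr_gt0//=.
have [r [r0 rd hr]] := hx _ d60.
have [r1 r6] : (r < 1 /\ 6 * r <= d)%R.
  move: rd; rewrite lt_min => /andP[h ->]; split => //.
  by rewrite mulrC -ler_pdivlMr// ltW.
have [k [k1 k2]] := dyadic_scale r0 r1.
set z := dyadic_index k x.
have xz (f : {ffun 'I_n -> 'I_3}) : dyadic_neighbourhood k (dyadic_shift z f) x.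
  move=> i; rewrite [dyadic_shift _ _ _]ffunE -/z.
  move: (z i) (nat_of_ord (f i)) (ltn_ord (f i)) => a b; clear=> b3.
  by lia.
have nbB f : dyadic_neighbourhood k (dyadic_shift z f) `<=` ball x (6 * r).
  apply: sub_dyadic_neighbourhood_ball (xz f); first by rewrite mulr_gt0.
  have -> : (2 ^+ k * (6 * r) = 3 * (2 ^+ k * (2 * r)))%R by ring.
  by rewrite ler_peMr// ltW.
suff [f hf] : exists f, lam%:E * s (dyadic_neighbourhood k (dyadic_shift z f)) <=
    rho (dyadic_cell k (dyadic_shift z f)).
  exists (k, dyadic_shift z f) => //=; split => //.
  apply: subset_trans (@sub_dyadic_cell_neighbourhood _ _ _ _) _.
  by apply: subset_trans (@nbB f) _; apply: subset_trans dU; exact: le_ball.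
apply: contrapT => /forallNP nf.
have cell_le f : rho (dyadic_cell k (dyadic_shift z f)) <= lam%:E * s (ball x (6 * r)%R).
  have /negP := nf f; rewrite -ltNge => /ltW /le_trans; apply.
  apply: lee_wpmul2l; first by rewrite lee_fin ltW.
  apply: le_measure; rewrite ?inE.
  - exact: measurable_dyadic_neighbourhood.
  - by apply: open_measurable_rV; exact: ball_open.
  - exact: nbB.
move: hr; apply/negP; rewrite -leNgt.
pose en := enum {: {ffun 'I_n -> 'I_3}}.
apply: (@le_trans _ _ (rho (\big[setU/set0]_(f <- en) dyadic_cell k (dyadic_shift z f)))).
  apply: le_measure; rewrite ?inE.
  - by apply: open_measurable_rV; exact: ball_open.
  - by apply: bigsetU_measurable => f _; exact: measurable_dyadic_cell.
  - apply: subset_trans (sub_ball_dyadic_neighbourhood r0 k1) _.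
    rewrite dyadic_neighbourhood_cells -bigcup_seq => y [f _ fy].
    by exists f => //=; rewrite mem_enum.
apply: le_trans (measure_bigsetU_le en _ cell_le) _.
  by move=> f; exact: measurable_dyadic_cell.
rewrite muleA -EFinM -cardE card_ffun !card_ord natrX.
exact: lexx.
Qed.

End frequent_ball_covering.

(** * Directions of a vector measure *)
Lemma negligible_small_covers {d : measure_display} {T : measurableType d}
    {R : realType} (m : {measure set T -> \bar R}) (A : set T) :
  (forall e : R, 0 < e -> exists C, [/\ measurable C, A `<=` C & (m C <= e%:E)%E]) ->
  m.-negligible A.
Proof.
move=> h; have /choice[C hC] : forall j, exists C,
    [/\ measurable C, A `<=` C & (m C <= (j.+1%:R^-1)%:E)%E].
  by move=> j; apply: h; rewrite invr_gt0.
have mC : measurable (\bigcap_j C j).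
  by apply: bigcapT_measurable => j; have [] := hC j.
exists (\bigcap_j C j); split => //; last by move=> x Ax j _; have [_ + _] := hC j; apply.
apply/eqP; rewrite eq_le measure_ge0 andbT.
apply/lee_addgt0Pr => e e0; rewrite add0e.
have [j _ /(_ j (leqnn j)) /= je] := near_infty_natSinv_lt (PosNum e0).
have [mCj _ mj] := hC j.
apply: (@le_trans _ _ (m (C j))).
  by apply: le_measure; rewrite ?inE//; exact: bigcap_inf.
by apply: le_trans mj _; rewrite lee_fin ltW.
Qed.

Section directions.
Context {R : realType} {n : nat} {W : vectType R} (dW : {dot W for idfun}).
Variables (Omega : set 'rV[R]_n) (mu : set 'rV[R]_n -> W).
Hypothesis oO : open Omega.
Hypothesis muP : locally_bounded_measure dW Omega mu.
Variable s : {measure set 'rV[R]_n -> \bar R}.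
Hypothesis sE : forall A, measurable A -> s A = variation_measure dW Omega mu A.
Variable B : set 'rV[R]_n.
Hypothesis mB : measurable B.
Hypothesis ciB : compactly_inside Omega B.

(** For [|w| <= 1] this is a positive measure; it is small where the polar
    vector of [mu] is close to [w]. *)
Definition misalignment (w : W) (A : set 'rV[R]_n) : R := fine (s A) - dW (mu A) w.

Lemma s_fin_num A : measurable A -> compactly_inside Omega A -> s A \is a fin_num.
Proof.
by move=> mA cA; rewrite ge0_fin_numE// sE//; exact: variation_compactly_inside_lty.
Qed.

Lemma dot_mu_le_s w A : dnorm dW w <= 1 -> measurable A -> compactly_inside Omega A ->
  `|dW (mu A) w| <= fine (s A).
Proof.
move=> w1 mA cA; rewrite -lee_fin fineK ?s_fin_num// sE//.
apply: le_trans (le_norm_variation _ _ _ _) => //.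
rewrite lee_fin (le_trans (cauchy_schwarz _ _ _))//.
by rewrite ler_piMr// dnorm_ge0.
Qed.

Lemma misalignment_ge0 w A : dnorm dW w <= 1 -> measurable A ->
  compactly_inside Omega A -> 0 <= misalignment w A.
Proof.
by move=> w1 mA cA; rewrite subr_ge0 (le_trans (ler_norm _))// dot_mu_le_s.
Qed.

(** The restriction to [B] is needed because [mu] has no meaning on sets
    that approach the boundary of [Omega]. *)
Lemma exists_misalignment_measure w : dnorm dW w <= 1 ->
  exists rho : {measure set 'rV[R]_n -> \bar R},
    forall A, measurable A -> rho A = (misalignment w (A `&` B))%:E.
Proof.
move=> w1.
have ciIB A : compactly_inside Omega (A `&` B).
  by apply: compactly_insideS ciB => x [].
apply: measure_of_set_function.
- by rewrite set0I /misalignment measure0 (mu_set0 muP) linear0l subr0.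
- move=> A mA; rewrite lee_fin; apply: misalignment_ge0 => //.
  exact: measurableI.
- move=> F mF tF mUF.
  have mFB k : measurable (F k `&` B) by exact: measurableI.
  have mUB : measurable (\bigcup_k (F k `&` B)) by exact: bigcup_measurable.
  have tFB : trivIset setT (fun k => F k `&` B) by exact: trivIset_setIr.
  have c1 : \sum_(0 <= k < N) fine (s (F k `&` B)) @[N --> \oo] -->
      fine (s (\bigcup_k (F k `&` B))).
    have finU : s (\bigcup_k (F k `&` B)) \is a fin_num.
      by rewrite s_fin_num// -setI_bigcupl.
    have E N : \sum_(0 <= k < N) fine (s (F k `&` B)) =
        fine (\sum_(0 <= k < N) s (F k `&` B)).
      by rewrite sum_fine// => k _; rewrite s_fin_num.
    under eq_fun do rewrite E.
    have := @measure_semi_sigma_additive _ _ _ s (fun k => F k `&` B) mFB tFB mUB.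
    by rewrite -(fineK finU) => /fine_cvg.
  have c2 : \sum_(0 <= k < N) dW (mu (F k `&` B)) w @[N --> \oo] -->
      dW (mu (\bigcup_k (F k `&` B))) w.
    under eq_fun do rewrite big_mkord.
    have pFB : countable_partition Omega (\bigcup_k (F k `&` B)) (fun k => F k `&` B).
      by split.
    by apply: (dot_mu_sigma_additive (w := w) muP _ pFB); rewrite -setI_bigcupl.
  under eq_fun do rewrite sumEFin.
  apply/fine_cvgP; split; first by apply: nearW.
  rewrite setI_bigcupl /misalignment /comp /=; under eq_fun do rewrite sumrB.
  exact: cvgB c1 c2.
Qed.

(** On a piece [F k] of a partition that almost attains the variation of [B],
    the measure [misalignment w] with [w] the direction of [mu (F k)] has the
    small mass [s (F k) - |mu (F k)|]. [frequent_ball_covering] then bounds the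
    set of points where its density is frequently large, and the bounds add up
    over [k] to a multiple of the defect of the partition. *)
Lemma exists_aligned_direction (lam : R) : open B -> 0 < lam ->
  s.-negligible [set x | B x /\ ~ exists w, dnorm dW w <= 1 /\
    exists2 d : R, 0 < d & forall r, 0 < r -> r < d ->
      misalignment w (ball x r `&` B) <= lam * fine (s (ball x (6 * r) `&` B))].
Proof.
move=> oB lam0; apply: negligible_small_covers => e e0.
set bad := [set x | _].
have BO : B `<=` Omega by case: ciB => K [_ BK KO]; exact: subset_trans KO.
have n3 : 0 < 3 ^+ n :> R by rewrite exprn_gt0.
pose lam' := lam / 3 ^+ n.
have lam'0 : 0 < lam' by rewrite divr_gt0.
pose eta := lam' * e / 2.
have eta0 : 0 < eta by rewrite !mulr_gt0.
have sBfin : s B \is a fin_num by exact: s_fin_num.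
have ciSB A : A `<=` B -> compactly_inside Omega A.
  by move=> AB; exact: compactly_insideS ciB.
have [_ [F pF <-] ltF] : exists2 y, [set (\sum_(k <oo) (dnorm dW (mu (F k)))%:E)%E |
    F in countable_partition Omega (B `&` Omega)] y & (s B - eta%:E < y)%E.
  by have := sBfin; rewrite sE// => fin; exact: ub_ereal_sup_adherent.
have [mF cF tF UF] := pF.
have FB k : F k `<=` B.
  by move=> x Fx; have [] : (B `&` Omega) x by rewrite -UF; exists k.
(* When [mu (F k) = 0] the convention [0^-1 = 0] gives [w k = 0]. *)
pose w k := (dnorm dW (mu (F k)))^-1 *: mu (F k).
have w1 k : dnorm dW (w k) <= 1.
  rewrite dnormZ ger0_norm ?invr_ge0 ?dnorm_ge0//.
  have [->|h] := eqVneq (dnorm dW (mu (F k))) 0; first by rewrite mulr0.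
  by rewrite mulVf.
have muw k : dW (mu (F k)) (w k) = dnorm dW (mu (F k)).
  rewrite dotZr -sqr_dnorm.
  have [->|h] := eqVneq (dnorm dW (mu (F k))) 0; first by rewrite expr0n mulr0.
  by rewrite expr2 mulrA mulVf// mul1r.
have /choice[rho rhoE] : forall k, exists rho : {measure set 'rV[R]_n -> \bar R},
    forall A, measurable A -> rho A = (misalignment (w k) (A `&` B))%:E.
  by move=> k; exact: exists_misalignment_measure.
have rhoT k : (rho k setT < +oo)%E by rewrite rhoE ?ltry.
pose sB := mrestr s mB.
pose ek k : R := eta / (2 ^ k.+1)%:R.
have ek0 k : 0 < ek k by rewrite (divr_gt0 eta0)// ltr0n expn_gt0.
have /choice[C hC] : forall k, exists C : set 'rV[R]_n, [/\ measurable C,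
    [set x | F k x /\ forall d : R, (0 < d)%R -> exists r, [/\ (0 < r)%R, (r < d)%R &
      ((3 ^+ n * lam')%:E * sB (ball x (6 * r)%R) < rho k (ball x r))%E]] `<=` C &
    (lam'%:E * sB C <= rho k (F k) + (ek k)%:E)%E].
  by move=> k; exact: (frequent_ball_covering sB (rhoT k) lam'0 (ek0 k) (mF k)).
exists ((\bigcup_k C k) `&` B); split.
- apply: measurableI => //; apply: bigcup_measurable => k _; by have [] := hC k.
- move=> x [Bx nx]; split=> //.
  have [k _ Fkx] : (\bigcup_k F k) x by rewrite UF; split=> //; exact: BO.
  exists k => //; have [_ + _] := hC k; apply; split=> // d d0.
  apply: contrapT => nr; apply: nx; exists (w k); split; first exact: w1.
  exists d => // r r0 rd.
  have mb t : 0 < t -> measurable (ball x t).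
    by move=> t0; apply: open_measurable_rV; exact: ball_open.
  rewrite leNgt; apply/negP => h; apply: nr; exists r; split=> //.
  have r6 : 0 < 6 * r by rewrite mulr_gt0.
  rewrite rhoE; last exact: mb.
  rewrite mulrC divfK ?gt_eqF// /sB /mrestr.
  rewrite -[X in (_ * X)%E]fineK; first by rewrite -EFinM lte_fin.
  apply: s_fin_num; first by apply: measurableI => //; exact: mb.
  by apply: ciSB => y [].
- have mC k : measurable (C k) by have [] := hC k.
  rewrite -(@lee_pmul2l _ lam'%:E) ?lte_fin//.
  apply: (@le_trans _ _ (lam'%:E * \sum_(k <oo) sB (C k))%E).
    apply: lee_wpmul2l; first by rewrite lee_fin ltW.
    apply: (measure_sigma_subadditive sB) => //; exact: bigcup_measurable.
  rewrite -nneseriesZl; last by move=> *; exact: measure_ge0.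
  pose a k := misalignment (w k) (F k).
  have a0 k : 0 <= a k by exact: misalignment_ge0.
  have aE k : rho k (F k) = (a k)%:E by rewrite rhoE// setIidl.
  apply: (@le_trans _ _ (\sum_(k <oo) ((a k)%:E + (ek k)%:E))%E).
    apply: lee_nneseries => [k _|k _]; first by rewrite mule_ge0// lee_fin ltW.
    by rewrite -aE; have [] := hC k.
  apply: le_trans (epsilon_trick _ _ (ltW eta0)) _ => //.
  have suma : (\sum_(k <oo) (a k)%:E + \sum_(k <oo) (dnorm dW (mu (F k)))%:E = s B)%E.
    rewrite -nneseriesD; last 2 first.
    + by move=> *; rewrite lee_fin.
    + by move=> *; rewrite lee_fin dnorm_ge0.
    rewrite -(setIidl BO) -UF measure_semi_bigcup//; last exact: bigcup_measurable.
    apply: eq_eseriesr => k _.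
    by rewrite /a /misalignment muw -EFinD subrK fineK// s_fin_num.
  have afin : (\sum_(k <oo) (a k)%:E)%E \is a fin_num.
    rewrite ge0_fin_numE; last by apply: nneseries_ge0 => *; rewrite lee_fin.
    apply: (@le_lt_trans _ _ (s B)); last by rewrite -ge0_fin_numE.
    by rewrite -suma leeDl//; apply: nneseries_ge0 => *; rewrite lee_fin dnorm_ge0.
  have lea : (\sum_(k <oo) (a k)%:E <= eta%:E)%E.
    move: ltF; rewrite -suma lteBlDr// [X in (_ < X)%E]addeC lteD2rE//.
      by move/ltW.
    by move: sBfin; rewrite -suma fin_numD => /andP[].
  apply: le_trans (leeD2r _ lea) _; rewrite -EFinD -EFinM lee_fin /eta.
  by rewrite -splitr.
Qed.

End directions.

(** * Smooth bumps *)
Section derive_along_lines.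
Context {R : realType} {n : nat}.

Lemma is_derive_line (f : 'rV[R]_n -> R) (x v : 'rV[R]_n) (d : R) :
  is_derive x v f d <-> is_derive (0 : R) 1 (fun h => f (h *: v + x)) d.
Proof.
have E : (fun h : R => h^-1 *: ((f \o shift x) (h *: v) - f x)) =
    (fun h : R => h^-1 *: (((fun h => f (h *: v + x)) \o shift 0) (h *: 1) -
       f (0 *: v + x))).
  by rewrite funeqE => h /=; rewrite addr0 scale0r add0r [_%:A]mulr1.
by split=> -[df dE]; split; move: df dE; rewrite /derivable /derive E.
Qed.

Lemma is_derive_scale (f : 'rV[R]_n -> R) (a x v : 'rV[R]_n) (c d : R) :
  is_derive (c *: (x - a)) v f d ->
  is_derive x v (fun y => f (c *: (y - a))) (d * c).
Proof.
move=> /is_derive_line fd; apply/is_derive_line.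
have -> : (fun h : R => f (c *: (h *: v + x - a))) =
    (fun h => f (h *: v + c *: (x - a))) \o (fun h => c * h).
  by apply/funext => h /=; rewrite -addrA scalerDr scalerA.
apply: is_derive1_comp; first by rewrite mulr0.
have -> : (fun h : R => c * h) = c *: (id : R -> R) by apply/funext.
by apply: is_derive_eq; rewrite [_ *: _]mulr1.
Qed.

End derive_along_lines.

Section flat_exponential.
Context {R : realType}.

(** The derivatives of [exp (- 1 / t)], extended by [0] to [t <= 0], are linear
    combinations of these functions. *)
Definition flat_exp (k : nat) (t : R) : R :=
  if 0 < t then t ^- k * expR (- t^-1) else 0.

Lemma flat_exp_ge0 k t : 0 <= flat_exp k t.
Proof.
rewrite /flat_exp; case: ifPn => // t0.
by rewrite mulr_ge0 ?expR_ge0// invr_ge0 exprn_ge0// ltW.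
Qed.

(** From [s ^ (k + 2) / (k + 2)! <= exp s] at [s = 1 / t]. The quadratic bound
    makes the derivative at [0] vanish. *)
Lemma flat_exp_bound k t : `|flat_exp k t| <= (k.+2)`!%:R * t ^+ 2.
Proof.
rewrite ger0_norm ?flat_exp_ge0// /flat_exp; case: ifPn => [t0|_]; last first.
  by rewrite mulr_ge0// sqr_ge0.
have s0 : 0 < t^-1 by rewrite invr_gt0.
have := expR_ge1Dxn k.+1 (ltW s0).
set F := (k.+2)`!%:R; have F0 : 0 < F :> R by rewrite ltr0n fact_gt0.
move=> h; have {}h : t^-1 ^+ k.+2 <= F * expR t^-1.
  rewrite mulrC -ler_pdivrMr//; apply: le_trans h; by rewrite lerDr.
rewrite expRN ler_pdivrMr ?expR_gt0// mulrAC.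
have -> : t ^- k = t^-1 ^+ k.+2 * t ^+ 2.
  by rewrite -addn2 exprD -mulrA -exprMn mulVf ?gt_eqF// expr1n mulr1 exprVn.
by rewrite ler_wpM2r ?sqr_ge0.
Qed.

Lemma is_derive_flat_exp k (t : R) :
  is_derive t 1 (flat_exp k) (flat_exp k.+2 t - k%:R * flat_exp k.+1 t).
Proof.
have [t0|t0|->] := ltgtP t 0.
- have -> : flat_exp k.+2 t - k%:R * flat_exp k.+1 t = 0.
    by rewrite /flat_exp ltNge (ltW t0)/= mulr0 subr0.
  have h := is_derive_cst (0 : R) t (1 : R).
  apply: near_eq_is_derive h.
  near=> s; rewrite /flat_exp ifF//; apply/negbTE; rewrite -leNgt ltW//.
  by near: s; exact: lt_nbhsl.
- suff h : is_derive t 1 (fun s : R => (s^-1) ^+ k * expR (- s^-1))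
      (flat_exp k.+2 t - k%:R * flat_exp k.+1 t).
    apply: near_eq_is_derive h.
    near=> s; rewrite /flat_exp ifT ?exprVn//.
    by near: s; exact: lt_nbhsr.
  have tN0 : t != 0 by rewrite gt_eqF.
  have dV : is_derive t 1 (fun s : R => s^-1) (- t ^- 2).
    have := @is_deriveV R id t 1 1 tN0 (is_derive_id _ _).
    by move=> h; apply: (is_derive_eq h); rewrite [_ *: _]mulr1.
  have dE : is_derive t 1 (fun s : R => expR (- s^-1)) (expR (- t^-1) * t ^- 2).
    have dN : is_derive t 1 (fun s : R => - s^-1) (t ^- 2).
      by have := is_deriveN dV; rewrite opprK.
    exact: (@is_derive1_comp _ expR (fun s => - s^-1) t _ _ (is_derive_expR _) dN).
  have dX : is_derive t 1 (fun s : R => s^-1 ^+ k) (- (k%:R * t ^- k.+1)).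
    have := @is_deriveX _ _ (fun s : R => s^-1) k t 1 _ dV.
    rewrite (_ : (fun s => s^-1) ^+ k = (fun s : R => s^-1 ^+ k)); last first.
      by apply/funext => s; rewrite exprfctE.
    move=> h; apply: (is_derive_eq h).
    rewrite [_ *: _]mulrN; congr (- _); rewrite -mulrA; case: (k) => [|j].
      by rewrite !mul0r.
    by congr (_ * _); rewrite /= -!exprVn -exprD addn2.
  have := is_deriveM dX dE.
  move=> h; apply: (is_derive_eq h).
  have sE (a b : R) : a *: b = a * b by [].
  rewrite /flat_exp t0 !sE.
  rewrite -!exprVn.
  move: (expR _) => E; move: (t^-1) => u; rewrite !exprS expr0.
  by ring.
- have -> : flat_exp k.+2 0 - k%:R * flat_exp k.+1 0 = 0 :> R.
    by rewrite /flat_exp ltxx mulr0 subr0.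
  set C : R := (k.+2)`!%:R.
  have C0 : 0 < C by rewrite ltr0n fact_gt0.
  have cv : (fun h : R => h^-1 *: ((flat_exp k \o shift 0) (h *: 1) - flat_exp k 0)) @ 0^' --> (0 : R).
    apply/cvgr0Pnorm_lt => e e0.
    near=> h.
    have h0 : h != 0 by near: h; exact: nbhs_dnbhs_neq.
    rewrite /= [_%:A]mulr1 addr0 {2}/flat_exp ltxx subr0.
    rewrite (_ : _ *: _ = h^-1 * flat_exp k h)// normrM normfV.
    rewrite mulrC ltr_pdivrMr ?normr_gt0//.
    apply: le_lt_trans (flat_exp_bound _ _) _.
    rewrite -real_normK ?num_real// expr2 mulrA ltr_pM2r ?normr_gt0//.
    rewrite -ltr_pdivlMl//.
    near: h; apply: dnbhs0_lt; by rewrite mulr_gt0 ?invr_gt0.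
  split; first by apply/cvg_ex; exists 0.
  exact: cvg_lim cv.
Unshelve. all: by end_near. Qed.

Lemma continuous_flat_exp k : continuous (@flat_exp k).
Proof.
move=> t; apply: differentiable_continuous; apply/derivable1_diffP.
by have [] := is_derive_flat_exp k t.
Qed.

Lemma flat_exp0_le1 t : flat_exp 0 t <= 1.
Proof.
rewrite /flat_exp; case: ifPn => // t0; rewrite expr0 invr1 mul1r expR_le1.
by rewrite oppr_le0 invr_ge0 ltW.
Qed.

Lemma flat_exp0_ge t : 2^-1 <= t -> expR (- 2) <= flat_exp 0 t.
Proof.
move=> ht; have t0 : 0 < t by apply: lt_le_trans ht.
by rewrite /flat_exp t0 expr0 invr1 mul1r ler_expR lerN2 invf_ple ?posrE.
Qed.

End flat_exponential.

Section flat_algebra.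
Context {R : realType} {n : nat}.

(** Closing these functions under sums and products yields a class of
    differentiable functions that is stable under partial derivatives, so that
    its members are smooth. *)
Inductive flat_algebra : ('rV[R]_n -> R) -> Prop :=
| flat_algebra_cst c : flat_algebra (fun=> c)
| flat_algebra_coord k i c b :
    flat_algebra (fun x => flat_exp k (c * x ord0 i + b))
| flat_algebra_add f g :
    flat_algebra f -> flat_algebra g -> flat_algebra (fun x => f x + g x)
| flat_algebra_mul f g :
    flat_algebra f -> flat_algebra g -> flat_algebra (fun x => f x * g x).

Lemma continuous_flat_algebra f : flat_algebra f -> continuous f.
Proof.
elim=> {f} [c|k i c b|f g _ cf _ cg|f g _ cf _ cg] x.
- exact: cst_continuous.
- apply: (@continuous_comp _ _ _ (fun x : 'rV[R]_n => c * x ord0 i + b)).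
    have cx : (fun y : 'rV[R]_n => y ord0 i) @ x --> x ord0 i by exact: coord_continuous.
    exact: cvgD (cvgM (cvg_cst c) cx) (cvg_cst b).
  exact: continuous_flat_exp.
- exact: cvgD (cf x) (cg x).
- exact: cvgM (cf x) (cg x).
Qed.

Lemma is_derive_flat_algebra f i : flat_algebra f ->
  exists2 g, flat_algebra g & forall x, is_derive x (delta_mx ord0 i) f (g x).
Proof.
elim=> {f} [c|k j c b|f g fa [f' f'a df] ga [g' g'a dg]|f g fa [f' f'a df] ga [g' g'a dg]].
- exists (fun=> 0); first exact: flat_algebra_cst.
  by move=> x; exact: is_derive_cst.
- pose L (x : 'rV[R]_n) := c * x ord0 j + b.
  pose e : R := c * (delta_mx ord0 i : 'rV[R]_n) ord0 j.
  exists (fun x => e * (flat_exp k.+2 (L x) + (- k%:R) * flat_exp k.+1 (L x))).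
    apply: flat_algebra_mul; first exact: flat_algebra_cst.
    apply: flat_algebra_add; first exact: flat_algebra_coord.
    apply: flat_algebra_mul; first exact: flat_algebra_cst.
    exact: flat_algebra_coord.
  move=> x; apply/is_derive_line.
  have -> : (fun h : R => flat_exp k (c * (h *: delta_mx ord0 i + x) ord0 j + b)) =
      flat_exp k \o (fun h => h * e + L x).
    by apply/funext => h /=; rewrite !mxE /L /e !mxE; congr flat_exp; ring.
  rewrite mulrC mulNr.
  apply: is_derive1_comp.
    by rewrite mul0r add0r; exact: is_derive_flat_exp.
  have -> : (fun h : R => h * e + L x) = e *: (id : R -> R) + cst (L x).
    by apply/funext => h /=; rewrite mulrC.
  by apply: is_derive_eq; rewrite addr0 [_ *: _]mulr1.
- exists (fun x => f' x + g' x); first exact: flat_algebra_add.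
  by move=> x; have := df x; have := dg x; move=> ? ?; exact: is_deriveD.
- exists (fun x => f x * g' x + g x * f' x).
    by apply: flat_algebra_add; exact: flat_algebra_mul.
  by move=> x; have := df x; have := dg x; move=> ? ?; exact: is_deriveM.
Qed.

Lemma flat_algebra_partial i f : flat_algebra f -> flat_algebra (partial i f).
Proof.
move=> fa; have [g ga dg] := is_derive_flat_algebra i fa.
suff -> : partial i f = g by [].
by apply/funext => x; have [_] := dg x.
Qed.

Lemma smooth_flat_algebra f : flat_algebra f -> smooth f.
Proof.
move=> fa s; have sa : flat_algebra (foldr (@partial R n) f s).
  by elim: s => //= i s; exact: flat_algebra_partial.
split; first exact: continuous_flat_algebra.
move=> x i; have [g _ dg] := is_derive_flat_algebra i sa.
by have [] := dg x.
Qed.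

Lemma flat_algebra_prod (s : seq 'I_n) (F : 'I_n -> 'rV[R]_n -> R) :
  (forall i, flat_algebra (F i)) -> flat_algebra (fun x => \prod_(i <- s) F i x).
Proof.
move=> Fa; elim: s => [|i s IH].
  under eq_fun do rewrite big_nil; exact: flat_algebra_cst.
by under eq_fun do rewrite big_cons; exact: flat_algebra_mul.
Qed.

End flat_algebra.

Section bump.
Context {R : realType} {n : nat}.
Implicit Types a x : 'rV[R]_n.

(** Each coordinate contributes [exp (- 1 / (1 + t)) * exp (- 1 / (1 - t))] with
    [t] the rescaled distance to the centre, which vanishes unless [|t| < 1]. *)
Definition bump a (r : R) x : R :=
  \prod_(i < n) (flat_exp 0 (1 + (x ord0 i - a ord0 i) / r) *
                 flat_exp 0 (1 - (x ord0 i - a ord0 i) / r)).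

Lemma flat_algebra_bump a r : flat_algebra (bump a r).
Proof.
apply: flat_algebra_prod => i; apply: flat_algebra_mul.
- rewrite (_ : (fun x => _) = (fun x : 'rV[R]_n =>
      flat_exp 0 (r^-1 * x ord0 i + (1 - a ord0 i / r)))); last first.
    by apply/funext => x; congr flat_exp; ring.
  exact: flat_algebra_coord.
- rewrite (_ : (fun x => _) = (fun x : 'rV[R]_n =>
      flat_exp 0 (- r^-1 * x ord0 i + (1 + a ord0 i / r)))); last first.
    by apply/funext => x; congr flat_exp; ring.
  exact: flat_algebra_coord.
Qed.

Lemma bump_ge0 a r x : 0 <= bump a r x.
Proof. by apply: prodr_ge0 => i _; rewrite mulr_ge0// flat_exp_ge0. Qed.

Lemma bump_le1 a r x : bump a r x <= 1.
Proof.
apply: (@le_trans _ _ (\prod_(i < n) 1)); last by rewrite big1.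
apply: ler_prod => i _; rewrite mulr_ge0 ?flat_exp_ge0//=.
by rewrite mulr_ile1// ?flat_exp_ge0// flat_exp0_le1.
Qed.

Lemma bump_eq0 a r x : 0 < r -> ~ ball a r x -> bump a r x = 0.
Proof.
move=> r0 /(contra_not (iffRL (ball_rVP _ _ r0))) /existsNP[i /negP].
rewrite -leNgt => ri; rewrite /bump (bigD1 i)//= [X in X * _](_ : _ = 0) ?mul0r//.
rewrite /flat_exp; case: ifPn => h1; last by rewrite mul0r.
case: ifPn => h2; last by rewrite mulr0.
exfalso; move: ri; apply/negP; rewrite -ltNge distrC.
rewrite -[x ord0 i - a ord0 i](@divfK _ r) ?gt_eqF//.
rewrite normrM (gtr0_norm r0) -[ltRHS]mul1r ltr_pM2r// ltr_norml.
by move: h1 h2; set q := _ / r => h1 h2; apply/andP; split; lra.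
Qed.

(** On the half-size ball every argument of [flat_exp] is at least [1 / 2]. *)
Lemma bump_lower_bound : exists2 c : R, 0 < c &
  forall a r x, 0 < r -> ball a (r / 2) x -> c <= bump a r x.
Proof.
exists (\prod_(i < n) (expR (- 2) * expR (- 2))).
  by apply: prodr_gt0 => i _; rewrite mulr_gt0 ?expR_gt0.
move=> a r x r0; have r2 : 0 < r / 2 by rewrite divr_gt0.
move=> /(ball_rVP _ _ r2) h; apply: ler_prod => i _.
rewrite mulr_ge0 ?expR_ge0//=.
have := h i; rewrite distrC ltr_norml => /andP[h1 h2].
have h1' : - (2^-1) <= (x ord0 i - a ord0 i) / r.
  by rewrite ler_pdivlMr// mulNr mulrC ltW.
have h2' : (x ord0 i - a ord0 i) / r <= 2^-1.
  by rewrite ler_pdivrMr// mulrC ltW.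
move: h1' h2'; set q := _ / r => h1' h2'.
by apply: ler_pM; rewrite ?expR_ge0//; apply: flat_exp0_ge; lra.
Qed.

Lemma bumpE a r x : bump a r x = bump 0 1 (r^-1 *: (x - a)).
Proof.
by apply: eq_bigr => i _; rewrite !mxE subr0 divr1 [r^-1 * _]mulrC.
Qed.

Lemma closed_ball_rV a (r : R) : 0 < r ->
  closed [set x : 'rV[R]_n | `|a - x| <= r] /\ compact [set x : 'rV[R]_n | `|a - x| <= r].
Proof.
move=> r0; have cl : closed [set x : 'rV[R]_n | `|a - x| <= r].
  by have := @closed_ball_closed _ _ a r; rewrite closed_ballE.
split=> //; apply: bounded_closed_compact => //.
exists (`|a| + r); split; first exact: num_real.
move=> M hM x /= axr; rewrite -(subKr a x).
by apply: le_trans (ler_normB _ _) _; apply: ltW; apply: le_lt_trans hM; rewrite lerD2l.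
Qed.

Lemma test_function_bump Omega a r : 0 < r ->
  [set x : 'rV[R]_n | `|a - x| <= r] `<=` Omega -> test_function Omega (bump a r).
Proof.
move=> r0 rO; have [cl co] := closed_ball_rV a r0.
have sub : closure [set x | bump a r x != 0] `<=` [set x | `|a - x| <= r].
  rewrite [X in _ `<=` X]((closure_id _).1 cl); apply: closure_subset => x /=.
  have [|nb] := pselect (ball a r x); first by rewrite -ball_normE /= => /ltW.
  by rewrite bump_eq0// eqxx.
split.
- exact/smooth_flat_algebra/flat_algebra_bump.
- by apply: subclosed_compact co sub; exact: closed_closure.
- exact: subset_trans rO.
Qed.

Lemma partial_bump_eq0 i a r x : 0 < r -> r < `|a - x| -> partial i (bump a r) x = 0.
Proof.
move=> r0 rx; rewrite /partial.
rewrite (@near_eq_derive _ _ _ _ (cst 0)) ?derive_cst//.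
have : nbhs x [set y | r < `|a - y|].
  have [cl _] := closed_ball_rV a r0.
  apply: open_nbhs_nbhs; split => //.
  have -> : [set y | r < `|a - y|] = ~` [set y : 'rV[R]_n | `|a - y| <= r].
    by apply/seteqP; split=> y /=; rewrite ltNge => /negP.
  exact: closed_openC.
apply: filterS => y ry; apply: bump_eq0 => //.
by rewrite -ball_normE /= ltNge => /negP; apply; exact: ltW.
Qed.

(** All bumps are rescalings of [bump 0 1], whose gradient is continuous with
    compact support. *)
Lemma partial_bump_bound : exists2 C : R, 0 <= C &
  forall i a r x, 0 < r -> `|partial i (bump a r) x| <= C / r.
Proof.
have [cl co] := closed_ball_rV 0 ltr01.
have bd i : exists2 C : R, 0 <= C & forall x, `|partial i (bump 0 1) x| <= C.
  have ci := continuous_flat_algebra (flat_algebra_partial i (flat_algebra_bump 0 1)).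
  have : compact (partial i (bump 0 1) @` [set x : 'rV[R]_n | `|0 - x| <= 1]).
    by apply: continuous_compact => //; exact: continuous_subspaceT.
  move=> /compact_bounded[M [_ hM]].
  exists (`|M| + 1) => // x; have [x1|x1] := leP `|0 - x| 1; last first.
    by rewrite partial_bump_eq0// normr0.
  by apply: hM; [rewrite (le_lt_trans (ler_norm _))// ltrDl|exists x].
have /choice[C hC] : forall i, exists C : R, 0 <= C /\ forall x, `|partial i (bump 0 1) x| <= C.
  by move=> i; have [C ? ?] := bd i; exists C.
exists (\sum_i C i); first by apply: sumr_ge0 => i _; have [] := hC i.
move=> i a r x r0.
have [g ga dg] := is_derive_flat_algebra i (flat_algebra_bump 0 1).
have gE y : partial i (bump 0 1) y = g y by have [_] := dg y.
have dba := is_derive_scale (dg (r^-1 *: (x - a))).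
have -> : bump a r = (fun y => bump 0 1 (r^-1 *: (y - a))).
  by apply/funext => y; exact: bumpE.
have [_ +] := dba; rewrite /partial => ->.
rewrite normrM normfV (gtr0_norm r0) ler_pM2r ?invr_gt0// -gE.
have [_ h] := hC i; apply: le_trans (h _) _.
rewrite (bigD1 i)//= lerDl sumr_ge0// => j _; by have [] := hC j.
Qed.

End bump.

(** * Integrals of partial derivatives *)
Section consrV_lines.
Context {R : realType}.

Lemma consrV_line0 n (y : 'rV[R]_n) (t : R) :
  consrV (0%R, y) + (t - consrV (0%R, y) ord0 ord0) *: delta_mx ord0 ord0 = consrV (t, y).
Proof.
apply/rowP => j; rewrite !mxE unlift_none/= subr0.
case: unliftP => [k|] ->; rewrite ?eqxx/=.
  by rewrite mulr0 addr0.
by rewrite mulr1 add0r.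
Qed.

Lemma consrV_line n (j : 'I_n) (a t : R) (y : 'rV[R]_n) :
  consrV (a, y) + (t - consrV (a, y) ord0 (lift ord0 j)) *: delta_mx ord0 (lift ord0 j) =
  consrV (a, y + (t - y ord0 j) *: delta_mx ord0 j).
Proof.
apply/rowP => k; rewrite !mxE liftK/=.
case: unliftP => [l|] ->; rewrite ?eqxx/= ?mxE.
  by rewrite eqxx (inj_eq (@lift_inj _ _)).
by rewrite mulr0 addr0.
Qed.

End consrV_lines.

Section integral_lines.
Context {R : realType}.
Local Open Scope ereal_scope.

Let box n (M : R) := [set x : 'rV[R]_n | forall i, (- M < x ord0 i <= M)%R].

Lemma lebesgue_rV_cube n (M : R) : (0 <= M)%R ->
  lebesgue_rV n [set x | forall i, (- M < x ord0 i <= M)%R] = ((M + M) ^+ n)%:E.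
Proof.
move=> M0; rewrite (@lebesgue_rV_box R n (fun=> - M)%R (fun=> M)); last first.
  by move=> i; lra.
by rewrite prodEFin; congr EFin; rewrite opprK prodr_const card_ord.
Qed.

(** By induction on the dimension and Fubini's theorem: the first coordinate is
    integrated first when it is the direction [i] of the lines, and last
    otherwise. *)
Lemma integral_lines_eq0 n (i : 'I_n) (G : 'rV[R]_n -> R) (M C : R) :
  (0 <= M)%R -> measurable_fun setT G ->
  (forall x, (`|G x| <= C)%R) ->
  (forall x : 'rV[R]_n, ~ (forall j, (- M < x ord0 j <= M)%R) -> G x = 0%R) ->
  (forall x : 'rV[R]_n, \int[lebesgue_measure]_t
    (G (x + (t - x ord0 i) *: delta_mx ord0 i)%R)%:E = 0) ->
  \int[lebesgue_rV n]_x (G x)%:E = 0.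
Proof.
move=> M0; elim: n i G => [[]//|n IH] i G mG GC G0 Gl.
pose p : {measure set (measurableTypeR R * 'rV[R]_n) -> \bar R} :=
  @lebesgue_measure R \x lebesgue_rV n.
have mGc : measurable_fun setT (G \o @consrV R n).
  by apply: measurableT_comp => //; exact: measurable_consrV.
have mEG : measurable_fun setT (EFin \o G) by exact/measurable_EFinP.
have mS : measurable (@consrV R n @^-1` (@box n.+1 M)).
  rewrite -[X in measurable X]setTI; apply: measurable_consrV => //.
  exact: measurable_box_rV.
have intGc : p.-integrable setT (EFin \o (G \o @consrV R n)).
  have : p.-integrable (@consrV R n @^-1` (@box n.+1 M)) (EFin \o (G \o @consrV R n)).
    apply: measurable_bounded_integrable => //.
    - have := @lebesgue_rV_cube n.+1 M M0; rewrite /= /lebesgue_step /pushforward => ->.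
      exact: ltry.
    - exact: measurable_funTS.
    - exists C; split; first exact: num_real.
      by move=> C' CC' x _; apply: le_trans (GC _) _; exact: ltW.
  move=> /(integrable_mkcond _ mS).1.
  congr (integrable _ _ _); apply/funext => x; rewrite patchE; case: ifPn => // /negP nS.
  by rewrite /= G0// => h; apply: nS; rewrite inE.
transitivity (\int[p]_x (G (consrV x))%:E).
  have := @integral_pushforward _ _ _ _ _ _ (@measurable_consrV R n) p setT (EFin \o G).
  rewrite preimage_setT => /(_ mEG intGc measurableT) <-.
  by apply: eq_measure_integral => //; exact: measurable_consrV.
case: (unliftP ord0 i) => [j|] ij.
- rewrite -(@integral12_prod_meas1 _ _ _ _ _ _ _ _ intGc).
  apply: integral0_eq => a _.
  apply: (IH j (fun y => G (consrV (a, y)))).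
  + apply: measurableT_comp => //; apply: measurableT_comp; first exact: measurable_consrV.
    exact: measurable_pair1.
  + by move=> x; exact: GC.
  + move=> y ny; apply: G0 => h; apply: ny => k.
    by have := h (lift ord0 k); rewrite mxE liftK.
  + move=> y; have := Gl (consrV (a, y)); rewrite ij.
    by under eq_integral do rewrite consrV_line.
- rewrite -(@integral21_prod_meas1 _ _ _ _ _ _ _ _ intGc).
  apply: integral0_eq => y _.
  have := Gl (consrV (0%R, y)); rewrite ij.
  by under eq_integral do rewrite consrV_line0.
Qed.

End integral_lines.

Section integral_partial.
Context {R : realType} {n : nat}.

Lemma measurable_continuous_rV (f : 'rV[R]_n -> R) :
  continuous f -> measurable_fun setT f.
Proof.
move=> cf; apply: (measurability _ (RGenOpens.measurableE R)) => _ [_ [a [b ->]] <-].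
rewrite setTI; apply: open_measurable_rV.
apply: open_comp; last exact: interval_open.
by move=> x _; exact: cf.
Qed.

(** Along a line in direction [i] the integral of [g] is the difference of two
    values of [f] outside its support. *)
Lemma integral_partial_eq0 (i : 'I_n) (f g : 'rV[R]_n -> R) (M C : R) :
  0 < M -> (forall x, is_derive x (delta_mx ord0 i) f (g x)) -> continuous g ->
  (forall x, `|g x| <= C) ->
  (forall x, M <= `|x| -> f x = 0) ->
  (forall x, M <= `|x| -> g x = 0) ->
  (\int[lebesgue_rV n]_x (g x)%:E = 0)%E.
Proof.
move=> M0 df cg gC f0 g0.
apply: (@integral_lines_eq0 _ _ i g M C) => //; first exact: ltW.
- exact: measurable_continuous_rV.
- move=> x nx; apply: g0; rewrite leNgt; apply/negP => xM; apply: nx => j.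
  have := le_lt_trans (norm_coord_le_norm x j) xM; rewrite ltr_norml => /andP[-> /ltW ->//].
- move=> x.
  pose e : 'rV[R]_n := delta_mx ord0 i.
  pose l (t : R) : 'rV[R]_n := x + (t - x ord0 i) *: e.
  have lM t : M <= `|t| -> M <= `|l t|.
    move=> Mt; apply: le_trans (norm_coord_le_norm _ i); rewrite !mxE !eqxx mulr1 addrC subrK//.
  have dl (t : R) : is_derive t 1 (f \o l) (g (l t)).
    have := df (l t) => /is_derive_line h.
    have -> : f \o l = (fun h : R => f (h *: e + l t)) \o (fun s => s - t).
      apply/funext => s /=; congr f; rewrite /l addrCA -scalerDl.
      by congr (_ + _ *: _); ring.
    rewrite -[g (l t)]mulr1; apply: is_derive1_comp; first by rewrite subrr.
    have -> : (fun s : R => s - t) = (id : R -> R) - cst t by apply/funext.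
    by apply: is_derive_eq; rewrite subr0.
  have cl : continuous (g \o l).
    move=> t; apply: continuous_comp; last exact: cg.
    rewrite /l; apply: (@cvgD _ _ _ _ _ (fun=> x) (fun t => (t - x ord0 i) *: e) x).
      exact: cvg_cst.
    apply: cvgZr_tmp; apply: cvgB; [exact: cvg_id|exact: cvg_cst].
  have -> : (\int[lebesgue_measure]_t (g (l t))%:E =
      \int[lebesgue_measure]_(t in `[(- M)%R, M]) (g (l t))%:E)%E.
    rewrite [RHS]integral_mkcond; apply: eq_integral => t _; rewrite patchE.
    case: ifPn => //; rewrite notin_setE /= in_itv/= => tM; rewrite g0//; apply: lM.
    rewrite leNgt; apply/negP => h; apply: tM; move: h; rewrite ltr_norml.
    by move=> /andP[/ltW -> /ltW ->].
  rewrite (@continuous_FTC2 _ (g \o l) (f \o l))//.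
  + by rewrite /= !f0 ?subee//; apply: lM; rewrite ?normrN gtr0_norm.
  + by rewrite ltrNl; lra.
  + exact: continuous_subspaceT.
  + have cfl : continuous (f \o l).
      move=> t; apply: differentiable_continuous; apply/derivable1_diffP.
      by have [] := dl t.
    split.
    * by move=> t _; have [] := dl t.
    * by apply: cvg_at_right_filter; exact: cfl.
    * by apply: cvg_at_left_filter; exact: cfl.
  + by move=> t _; rewrite derive1E; have [_] := dl t.
Qed.

End integral_partial.

(** * Integrals against a vector measure *)
Section integral_lower_bound.
Import HBSimple.
Context {R : realType} {n : nat} {W : vectType R} (dW : {dot W for idfun}).
Variables (Omega : set 'rV[R]_n) (mu : set 'rV[R]_n -> W).
Hypothesis oO : open Omega.
Hypothesis muP : locally_bounded_measure dW Omega mu.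
Variable s : {measure set 'rV[R]_n -> \bar R}.
Hypothesis sE : forall A, measurable A -> s A = variation_measure dW Omega mu A.

Lemma fine_measure_fibers (m : {measure set 'rV[R]_n -> \bar R})
    (f : {sfun 'rV[R]_n >-> R}) (D : set 'rV[R]_n) :
  measurable D -> (m D < +oo)%E ->
  \sum_(a \in range f) fine (m (f @^-1` [set a] `&` D)) = fine (m D).
Proof.
move=> mD Dfin.
have ff : finite_set (range f) by [].
have mf a : measurable (f @^-1` [set a] `&` D) by exact: measurableI.
rewrite [in RHS](_ : D = \big[setU/set0]_(a \in range f) (f @^-1` [set a] `&` D)); last first.
  rewrite fsbig_setU// ; apply/seteqP; split=> [x Dx|x [a _ []]//].
  by exists (f x).
rewrite measure_fsbig//; last first.
  by move=> a b _ _ [x [[<- _] [<- _]]].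
rewrite !fsbig_finite// sum_fine// => a _.
rewrite ge0_fin_numE//; apply: le_lt_trans Dfin.
by apply: le_measure; rewrite ?inE// => x [].
Qed.

Lemma dot_simple_integral (f : {sfun 'rV[R]_n >-> R}) (w : W) :
  dW (simple_integral mu f) w =
  \sum_(a \in range f) a * dW (mu (f @^-1` [set a])) w.
Proof.
rewrite /simple_integral !fsbig_finite// dot_suml.
by apply: eq_bigr => a _; rewrite dotZl.
Qed.

(** Formally, [<phi mu, w> = phi sigma - phi (misalignment w)], and the first
    integral is at least [c * sigma Q'] while the second one is at most
    [misalignment w Q]. This is checked on each level set of a simple function
    uniformly close to [phi], up to an error [e] times the mass of [K]. *)
Lemma is_integral_lower_bound (phi : 'rV[R]_n -> R) (v w : W) (c : R)
    (Q' Q : set 'rV[R]_n) :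
  is_integral dW Omega mu phi v -> dnorm dW w <= 1 -> 0 < c ->
  measurable Q' -> measurable Q -> compactly_inside Omega Q ->
  (forall x, 0 <= phi x) -> (forall x, phi x <= 1) ->
  (forall x, Q' x -> c <= phi x) -> (forall x, ~ Q x -> phi x = 0) ->
  c * fine (s Q') <= dW v w + misalignment dW mu s w Q.
Proof.
move=> [K [f [[cK KO] f0 fphi fv]]] w1 c0 mQ' mQ ciQ phi0 phi1 phic phiQ.
have mK : measurable K.
  by apply: closed_measurable_rV; apply: compact_closed => //; exact: norm_hausdorff.
have ciK : compactly_inside Omega K by exists K; split.
have [rho rhoE] := exists_misalignment_measure oO muP sE mK ciK w1.
have [rhoQ rhoQE] := exists_misalignment_measure oO muP sE mQ ciQ w1.
have Q'K : Q' `<=` K.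
  move=> x Q'x; apply: contrapT => nKx.
  have := phic _ Q'x; apply/negP; rewrite -ltNge.
  have [k _ /(_ k (leqnn k) x)] := fphi _ c0.
  by rewrite f0// sub0r normrN; apply: le_lt_trans; exact: ler_norm.
have sKfin : (s K < +oo)%E by rewrite -ge0_fin_numE// (s_fin_num oO muP sE).
have rhofin A : measurable A -> (rho A < +oo)%E by move=> mA; rewrite rhoE// ltry.
pose C : R := 1 + fine (s K) + fine (rho K).
have C0 : 0 < C.
  have : 0 <= fine (s K) by exact: fine_ge0.
  have : 0 <= fine (rho K) by exact: fine_ge0.
  by rewrite /C; lra.
apply/ler_addgt0Pr => e' e'0; pose e := e' / C.
have e0 : 0 < e by rewrite divr_gt0.
have [k1 _ hk1] := fphi _ e0.
move/cvgr0Pnorm_le : fv => /(_ _ e0)[k2 _ hk2].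
pose k := maxn k1 k2.
have {}hk1 x : `|f k x - phi x| < e by apply: (hk1 k (leq_maxl _ _)).
have {}hk2 : dnorm dW (simple_integral mu (f k) - v) <= e.
  by have := hk2 k (leq_maxr _ _); rewrite /= ger0_norm// dnorm_ge0.
have vw : dW (simple_integral mu (f k)) w <= dW v w + e.
  rewrite -lerBlDl -dotNl -dotDl (le_trans (ler_norm _))//.
  rewrite (le_trans (cauchy_schwarz _ _ _))// (le_trans _ hk2)//.
  by rewrite ler_piMr// dnorm_ge0.
(* For [a != 0] the level set lies in [K], where [mu] is meaningful; for
   [a = 0] the term vanishes whatever the value of [mu]. *)
pose A a := f k @^-1` [set a].
have mA a : measurable (A a) by rewrite /A.
have mAD a D : measurable D -> measurable (A a `&` D) by exact: measurableI.
pose sig a := fine (s (A a `&` K)).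
pose rh a := fine (rho (A a `&` K)).
have dotE a : a * dW (mu (A a)) w = a * sig a - a * rh a.
  have [->|a0] := eqVneq a 0; first by rewrite !mul0r subr0.
  have AK : A a `&` K = A a.
    apply: setIidl => x Ax; apply: contrapT => nK.
    by move/negP: a0; apply; rewrite -Ax f0.
  rewrite /sig /rh rhoE; last exact: mAD.
  by rewrite -setIA setIid AK /= /misalignment -mulrBr opprB addrC subrK.
have sig_ge0 a : 0 <= sig a by exact: fine_ge0.
have rh_ge0 a : 0 <= rh a by exact: fine_ge0.
have le_fine (m : {measure set 'rV[R]_n -> \bar R}) X Y : measurable X -> measurable Y ->
    (m Y < +oo)%E -> X `<=` Y -> fine (m X) <= fine (m Y).
  move=> mX mY Yfin XY; have mXY : (m X <= m Y)%E by apply: le_measure; rewrite ?inE.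
  apply: fine_le => //; rewrite ge0_fin_numE//; exact: le_lt_trans Yfin.
have fin_AK a : (s (A a `&` K) < +oo)%E.
  apply: le_lt_trans sKfin; apply: le_measure; rewrite ?inE//.
  exact: mAD.
have sig_bound a : c * fine (s (A a `&` Q')) - e * sig a <= a * sig a.
  have [[x [Ax Q'x]]|nAQ] := pselect (A a `&` Q' !=set0).
    have ca : c - e <= a.
      have := hk1 x; rewrite Ax ltr_distl => /andP[+ _]; have := phic _ Q'x; lra.
    have le1 : fine (s (A a `&` Q')) <= sig a.
      by apply: le_fine => //; [exact: mAD|exact: mAD|exact: setIS].
    apply: (@le_trans _ _ ((c - e) * sig a)); last by rewrite ler_wpM2r.
    by rewrite mulrBl lerD2r ler_wpM2l// ltW.
  have -> : A a `&` Q' = set0 by apply/eqP/negPn/negP => /set0P.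
  rewrite measure0/= mulr0 sub0r -mulNr.
  have [[x [Ax Kx]]|nAK] := pselect (A a `&` K !=set0).
    rewrite ler_wpM2r//; have := hk1 x; rewrite Ax ltr_distl => /andP[+ _].
    have := phi0 x; lra.
  have E : A a `&` K = set0 by apply/eqP/negPn/negP => /set0P.
  by rewrite /sig E measure0/= !mulr0.
have rh_bound a : a * rh a <= fine (rho (A a `&` Q)) + e * rh a.
  have [[x [[Ax Kx] nQx]]|nAQ] := pselect ((A a `&` K) `\` Q !=set0).
    rewrite ler_wpDl ?fine_ge0// ler_wpM2r//.
    by have := hk1 x; rewrite Ax phiQ// subr0 => /ltW; apply: le_trans; exact: ler_norm.
  have AQ : A a `&` K `<=` Q.
    by move=> x AKx; apply: contrapT => nQ; apply: nAQ; exists x.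
  have [[x [Ax Kx]]|nAK] := pselect (A a `&` K !=set0); last first.
    have E : A a `&` K = set0 by apply/eqP/negPn/negP => /set0P.
    by rewrite /rh E measure0/= !mulr0 addr0 fine_ge0.
  have a1 : a <= 1 + e.
    have := hk1 x; rewrite Ax ltr_distl => /andP[_]; have := phi1 x; lra.
  apply: (@le_trans _ _ ((1 + e) * rh a)); first by rewrite ler_wpM2r.
  rewrite mulrDl mul1r lerD2r; apply: le_fine; [exact: mAD|exact: mAD| |].
    by apply: rhofin; exact: mAD.
  by move=> y AKy; split; [case: AKy|exact: AQ].
have [vals valsE] : exists vals : seq R, forall F : R -> R,
    \sum_(a \in range (f k)) F a = \sum_(a <- vals) F a.
  by eexists => F; exact: fsbig_finite.
have sumE : dW (simple_integral mu (f k)) w =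
    \sum_(a <- vals) (a * sig a - a * rh a).
  by rewrite dot_simple_integral valsE; apply: eq_bigr => a _; exact: dotE.
have fibers (m : {measure set 'rV[R]_n -> \bar R}) D : measurable D -> (m D < +oo)%E ->
    \sum_(a <- vals) fine (m (A a `&` D)) = fine (m D).
  by move=> mD Dfin; rewrite -(@fine_measure_fibers m (f k) D mD Dfin) valsE.
have low : c * fine (s Q') - e * fine (s K) - fine (rho Q) - e * fine (rho K) <=
    dW (simple_integral mu (f k)) w.
  have sQ'fin : (s Q' < +oo)%E.
    by apply: le_lt_trans sKfin; apply: le_measure; rewrite ?inE.
  rewrite sumE -(fibers s Q')// -(fibers s K)// -(fibers rho Q)//; last exact: rhofin.
  rewrite -(fibers rho K)//; last exact: rhofin.
  rewrite !mulr_sumr -!sumrB; apply: ler_sum => a _.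
  have := sig_bound a; have := rh_bound a; rewrite /sig /rh.
  move: (fine _) (fine _) (fine _) (fine _) => p1 p2 p3 p4; lra.
have rhoQle : fine (rho Q) <= misalignment dW mu s w Q.
  have E : fine (rho Q) = fine (rhoQ (Q `&` K)).
    rewrite rhoE// rhoQE; last exact: measurableI.
    by rewrite /= setIAC setIid.
  rewrite E (_ : misalignment _ _ _ _ _ = fine (rhoQ Q)); last by rewrite rhoQE// setIid.
  apply: le_fine => //; [exact: measurableI|by rewrite rhoQE// ltry].
have eC : e' = e + e * fine (s K) + e * fine (rho K).
  by rewrite -{1}(@divfK _ C _ e') ?gt_eqF// -/e /C; ring.
move: low vw rhoQle; rewrite eC; lra.
Qed.

End integral_lower_bound.

(** * Lebesgue points *)
Section right_upper_limits.
Context {R : realType}.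
Implicit Types f : R -> \bar R.

Lemma at_rightP (V : set R) : 0^'+ V <->
  exists2 d : R, 0 < d & forall r, 0 < r -> r < d -> V r.
Proof.
split=> [[/= d d0 h]|[d d0 h]].
  exists d => // r r0 rd; apply: h => //=.
  by rewrite sub0r normrN gtr0_norm.
exists d => //= r /=; rewrite sub0r normrN => rd r0; apply: h => //.
by apply: le_lt_trans rd; exact: ler_norm.
Qed.

Lemma limf_esup0_le f : limf_esup f 0^'+ = 0%E ->
  forall e : R, 0 < e -> exists2 d : R, 0 < d & forall r, 0 < r -> r < d -> (f r <= e%:E)%E.
Proof.
rewrite limf_esupE => f0 e e0.
have [|_ [V /at_rightP[d d0 dV] <-]] :=
  lb_ereal_inf_adherent e0 (S := [set ereal_sup (f @` V) | V in 0^'+]).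
  by rewrite f0.
rewrite f0 add0e => /ltW supV; exists d => // r r0 rd.
by apply: le_trans supV; apply: ereal_sup_ubound; exists r => //; exact: dV.
Qed.

Lemma limf_esup_eq0 f : (forall r, 0 < r -> (0 <= f r)%E) ->
  (forall e : R, 0 < e -> exists2 d : R, 0 < d & forall r, 0 < r -> r < d -> (f r <= e%:E)%E) ->
  limf_esup f 0^'+ = 0%E.
Proof.
move=> f0 h; apply/eqP; rewrite limf_esupE eq_le; apply/andP; split.
  apply/lee_addgt0Pr => e e0; rewrite add0e.
  have [d d0 hd] := h _ e0.
  apply: (@le_trans _ _ (ereal_sup (f @` [set r | 0 < r < d]))).
    apply: ereal_inf_lbound; exists [set r | 0 < r < d] => //.
    by apply/at_rightP; exists d => // r /= -> ->.
  by apply: ge_ereal_sup => _ [r /= /andP[r0 rd] <-]; exact: hd.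
apply: le_ereal_inf_tmp => _ [V /at_rightP[d d0 dV] <-].
have d20 : 0 < d / 2 by rewrite divr_gt0.
apply: le_trans (f0 _ d20) _; apply: ereal_sup_ubound; exists (d / 2) => //.
by apply: dV => //; rewrite ltr_pdivrMr// ltr_pMr// ltr1n.
Qed.

End right_upper_limits.

Section euclidean_balls.
Context {R : realType} {n : nat}.
Implicit Types x y : 'rV[R]_n.

Lemma norm_coord_le_enorm x i : `|x ord0 i| <= enorm x.
Proof.
rewrite /enorm -sqrtr_sqr ler_wsqrtr// (bigD1 i)//= lerDl.
by apply: sumr_ge0 => j _; exact: sqr_ge0.
Qed.

Lemma eball_sub_ball x (r : R) : eball x r `<=` ball x r.
Proof.
move=> y /= h; have r0 : 0 < r by apply: le_lt_trans h; exact: sqrtr_ge0.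
apply/(ball_rVP _ _ r0) => i; rewrite distrC; apply: le_lt_trans h.
by have := norm_coord_le_enorm (y - x) i; rewrite !mxE.
Qed.

(** Any factor above [sqrt n] would do; [n + 1] gives the strict inequality in
    the definition of [eball] in every dimension. *)
Lemma closed_ball_sub_eball x (r : R) : 0 < r ->
  [set y | `|x - y| <= r] `<=` eball x (n.+1%:R * r).
Proof.
move=> r0 y /= h; rewrite /eball /= /enorm.
have nr : 0 < n.+1%:R * r by rewrite mulr_gt0.
rewrite -[ltRHS](ger0_norm (ltW nr)) -sqrtr_sqr ltr_sqrt ?exprn_gt0//.
apply: (@le_lt_trans _ _ (\sum_(i < n) r ^+ 2)).
  apply: ler_sum => i _; rewrite -[leLHS]real_normK ?num_real//.
  rewrite ler_pXn2r ?nnegrE ?normr_ge0 ?(ltW r0)//; apply: le_trans h.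
  by rewrite distrC; exact: norm_coord_le_norm.
rewrite sumr_const card_ord -[ltLHS]mulr_natl exprMn ltr_pM2r ?exprn_gt0//.
by rewrite -natrX ltr_nat expnS expn1 (leq_trans (ltnSn n))// leq_pmulr.
Qed.

Lemma measurable_eball x (r : R) : measurable (eball x r).
Proof.
have mq : measurable_fun setT (fun y : 'rV[R]_n => enorm (y - x)).
  rewrite /enorm; apply: (@measurableT_comp _ _ _ _ _ _ (@Num.sqrt R)).
    by apply: continuous_measurable_fun => t; exact: sqrt_continuous.
  apply: measurable_sum => i; apply: measurable_funX.
  under eq_fun do rewrite !mxE.
  by apply: measurable_funB => //; exact: measurable_coord.
rewrite (_ : eball x r = setT `&` (fun y => enorm (y - x)) @^-1` `]-oo, r[%classic).
  by apply: mq => //; exact: measurable_itv.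
by apply/seteqP; split=> y; rewrite /eball /= in_itv/=; [|case].
Qed.

Lemma lebesgue_rV_eball_le x (r : R) : 0 < r ->
  (lebesgue_rV n (eball x r) <= ((2 * r) ^+ n)%:E)%E.
Proof.
move=> r0.
apply: (@le_trans _ _ (lebesgue_rV n [set y : 'rV[R]_n |
    forall i, x ord0 i - r < y ord0 i <= x ord0 i + r])).
  apply: le_measure; rewrite ?inE; [exact: measurable_eball|exact: measurable_box_rV|].
  move=> y /eball_sub_ball/(ball_rVP _ _ r0) h i.
  by have := h i; rewrite distrC ltr_distl => /andP[-> /ltW ->].
rewrite (@lebesgue_rV_box R n (fun i => x ord0 i - r) (fun i => x ord0 i + r)).
  rewrite prodEFin lee_fin (eq_bigr (fun=> 2 * r)) ?prodr_const ?card_ord//.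
  by move=> i _; ring.
by move=> i; lra.
Qed.

End euclidean_balls.

Section lebesgue_points.
Context {R : realType} {n : nat} {V : vectType R} (dV : {dot V for idfun}).
Variables (Omega : set 'rV[R]_n) (u : 'rV[R]_n -> V).
Hypothesis oO : open Omega.
Hypothesis uL1 : L1loc dV Omega u.

Lemma measurable_dot_sub (z e : V) :
  measurable_fun Omega (fun y => dV (u y - z) e).
Proof.
have [mu _] := uL1; under eq_fun do rewrite dotDl.
by apply: measurable_funD => //; exact: mu.
Qed.

(** The squared norm is a polynomial in inner products with fixed vectors. *)
Lemma measurable_dnorm_sub (z : V) : measurable_fun Omega (fun y => dnorm dV (u y - z)).
Proof.
have /choice[e he] := coord_dot dV (vbasis {:V}).
have E v : dV v v = \sum_i dV v (e i) * dV v (vbasis {:V})`_i.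
  rewrite {1}(coord_vbasis (memvf v)) dot_suml; apply: eq_bigr => i _.
  by rewrite dotZl -he (dotC dV v).
rewrite /dnorm; apply: (@measurableT_comp _ _ _ _ _ _ (@Num.sqrt R)).
  by apply: continuous_measurable_fun => t; exact: sqrt_continuous.
under eq_fun do rewrite E.
apply: measurable_sum => i; apply: measurable_funM; exact: measurable_dot_sub.
Qed.

Lemma integral_closed_ball_Lebesgue_point x : Omega x -> Lebesgue_point dV u x ->
  exists z : V, forall eps : R, 0 < eps -> exists2 d : R, 0 < d &
    forall r, 0 < r -> r < d -> [set y | `|x - y| <= r] `<=` Omega /\
      (\int[lebesgue_rV n]_(y in [set y | (`|x - y| <= r)%R]) (dnorm dV (u y - z))%:E
         <= (eps * r ^+ n)%:E)%E.
Proof.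
move=> Ox [z hz]; exists z => eps eps0.
have /nbhs_ballP[d1 /= d10 d1O] : nbhs x Omega by exact: open_nbhs_nbhs.
have N0 : 0 < n.+1%:R :> R by [].
pose eps' : R := eps / (2 * n.+1%:R) ^+ n.
have eps'0 : 0 < eps' by rewrite divr_gt0// exprn_gt0// mulr_gt0.
have [d2 d20 hd2] := limf_esup0_le hz eps'0.
exists (Num.min (d1 / n.+1%:R) (d2 / n.+1%:R)).
  by rewrite lt_min !divr_gt0.
move=> r r0; rewrite lt_min !ltr_pdivlMr// ![r * _]mulrC => /andP[rd1 rd2].
have sr : 0 < n.+1%:R * r by rewrite mulr_gt0.
have EO : eball x (n.+1%:R * r) `<=` Omega.
  apply: subset_trans d1O; apply: subset_trans (@eball_sub_ball _ _ _ _) _.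
  exact/le_ball/ltW.
have KE := @closed_ball_sub_eball R n x r r0.
split; first exact: subset_trans KE EO.
have mE := @measurable_eball R n x (n.+1%:R * r).
have mdE : measurable_fun (eball x (n.+1%:R * r)) (EFin \o (fun y => dnorm dV (u y - z))).
  apply/measurable_EFinP; apply: measurable_funS EO _; first exact: open_measurable_rV.
  exact: measurable_dnorm_sub.
have mK : measurable [set y | `|x - y| <= r].
  by apply: closed_measurable_rV; have [] := closed_ball_rV x r0.
apply: (@le_trans _ _ (\int[lebesgue_rV n]_(y in eball x (n.+1%:R * r)%R) (dnorm dV (u y - z))%:E)%E).
  by apply: ge0_subset_integral => // y _; rewrite lee_fin dnorm_ge0.
have Lle := lebesgue_rV_eball_le x sr.
have Lfin : lebesgue_rV n (eball x (n.+1%:R * r)) \is a fin_num.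
  by rewrite ge0_fin_numE//; apply: le_lt_trans Lle _; rewrite ltry.
have bound : eps' * (2 * (n.+1%:R * r)) ^+ n = eps * r ^+ n.
  by rewrite mulrA exprMn mulrA divfK// gt_eqF// exprn_gt0// mulr_gt0.
have := hd2 _ sr rd2; rewrite /average.
set I := (\int[_]_(y in eball _ _) _)%E => hI.
(* The average over a null ball is [0] by convention and carries no
   information, but then the integral vanishes as well. *)
have [L0|L0] := eqVneq (lebesgue_rV n (eball x (n.+1%:R * r))) 0%E.
  rewrite /I (null_set_integral mE mdE L0) lee_fin.
  by rewrite mulr_ge0 ?exprn_ge0 ?ltW.
have fL0 : 0 < fine (lebesgue_rV n (eball x (n.+1%:R * r))).
  by rewrite lt_def fine_ge0// andbT fine_eq0.
move: hI; rewrite lee_pdivrMl// => /le_trans; apply.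
rewrite -EFinM lee_fin -bound mulrC ler_wpM2l ?(ltW eps'0)//.
by rewrite -lee_fin fineK.
Qed.

(** The value [z] can be subtracted from [u] because the partial derivative of a
    bump has integral [0]. *)
Lemma Rintegral_partial_bump_bound i x (r C : R) (z e : V) : 0 < r ->
  [set y | `|x - y| <= r] `<=` Omega ->
  (forall y, `|partial i (bump x r) y| <= C / r) ->
  `|(\int[lebesgue_rV n]_(y in Omega) (partial i (bump x r) y * dV (u y) e))%R| <=
  C / r * dnorm dV e *
    fine (\int[lebesgue_rV n]_(y in [set y | (`|x - y| <= r)%R]) (dnorm dV (u y - z))%:E).
Proof.
move=> r0 KO hC; set h := partial i (bump x r); set K := [set y | `|x - y| <= r].
have [clK coK] := closed_ball_rV x r0.
have mK : measurable K by exact: closed_measurable_rV.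
have mO : measurable Omega by exact: open_measurable_rV.
have ch : continuous h.
  exact: continuous_flat_algebra (flat_algebra_partial i (flat_algebra_bump x r)).
have mh : measurable_fun setT h by exact: measurable_continuous_rV.
have hK y : ~ K y -> h y = 0.
  by move=> nK; apply: partial_bump_eq0 => //; rewrite ltNge; apply/negP.
have C0 : 0 <= C / r by apply: le_trans (hC x); exact: normr_ge0.
have LK : (lebesgue_rV n K < +oo)%E.
  apply: (@le_lt_trans _ _ (lebesgue_rV n (eball x (n.+1%:R * r)))).
    apply: le_measure; rewrite ?inE//; first exact: measurable_eball.
    exact: closed_ball_sub_eball.
  apply: le_lt_trans (lebesgue_rV_eball_le _ _) _; last by rewrite ltry.
  by rewrite mulr_gt0.
have toK (f : 'rV[R]_n -> R) D : K `<=` D ->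
    (\int[lebesgue_rV n]_(y in D) (h y * f y))%R = (\int[lebesgue_rV n]_(y in K) (h y * f y))%R.
  move=> KD; rewrite Rintegral_mkcond [RHS]Rintegral_mkcond; congr Rintegral.
  apply/funext => y; rewrite !patchE; case: ifPn => yD; case: ifPn => //.
    by rewrite notin_setE => /hK ->; rewrite mul0r.
  by rewrite inE => /KD; rewrite notin_setE in yD.
have ih : (lebesgue_rV n).-integrable K (EFin \o h).
  apply: measurable_bounded_integrable => //; first exact: measurable_funTS.
  exists (C / r); split; first exact: num_real.
  by move=> M hM y _; apply: le_trans (hC y) (ltW hM).
have inorm : (lebesgue_rV n).-integrable K (EFin \o (fun y => dnorm dV (u y - z))).
  have md v : measurable_fun K (EFin \o (fun y => dnorm dV (u y - v))).
    apply/measurable_EFinP; apply: measurable_funS KO _ => //.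
    exact: measurable_dnorm_sub.
  have iu : (lebesgue_rV n).-integrable K (EFin \o (fun y => dnorm dV (u y))).
    apply/integrableP; split; first by have := md 0; under eq_fun do rewrite subr0.
    have [_ /(_ _ coK KO)] := uL1; apply: le_lt_trans.
    rewrite le_eqVlt; apply/orP; left; apply/eqP; apply: eq_integral => y _ /=.
    by rewrite ger0_norm// dnorm_ge0.
  have ic : (lebesgue_rV n).-integrable K (EFin \o cst (dnorm dV z)).
    apply: measurable_bounded_integrable => //.
    exists (dnorm dV z); split; first exact: num_real.
    by move=> M hM y _ /=; rewrite ger0_norm ?dnorm_ge0// ltW.
  apply: (le_integrable mK (md z) _ (integrableD mK iu ic)) => y _ /=.
  rewrite lee_fin !ger0_norm ?addr_ge0 ?dnorm_ge0//.
  by rewrite -(dnormN dV z) ler_dnormD.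
have ihu : (lebesgue_rV n).-integrable K (EFin \o (fun y => h y * dV (u y - z) e)).
  have ib : (lebesgue_rV n).-integrable K
      (EFin \o (fun y => C / r * dnorm dV e * dnorm dV (u y - z))).
    by have := integrableZl mK (C / r * dnorm dV e) inorm.
  apply: le_integrable ib => //.
    apply/measurable_EFinP; apply: measurable_funM; first exact: measurable_funTS.
    by apply: measurable_funS KO _ => //; exact: measurable_dot_sub.
  move=> y _ /=; rewrite lee_fin normrM -mulrA [leRHS]ger0_norm; last first.
    by apply: mulr_ge0 => //; apply: mulr_ge0; exact: dnorm_ge0.
  by rewrite ler_pM// [leRHS]mulrC cauchy_schwarz.
have h0 : (\int[lebesgue_rV n]_(y in K) h y)%R = 0.
  have : (\int[lebesgue_rV n]_y (h y)%:E = 0)%E.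
    apply: (@integral_partial_eq0 _ _ i (bump x r) h (`|x| + r + 1) (C / r)) => //.
    - by rewrite ltr_pwDr// addr_ge0// ltW.
    - move=> y; apply: derivableP.
      by have [_ +] := smooth_flat_algebra (flat_algebra_bump x r) [::]; apply.
    - move=> y hy; apply: bump_eq0 => //; rewrite -ball_normE /= => xy.
      have := ler_normB x (x - y); rewrite opprB addrC subrK; lra.
    - move=> y hy; apply: hK => xy.
      have := ler_normB x (x - y); rewrite opprB addrC subrK; move: xy; rewrite /K/=; lra.
  have := toK (cst 1) setT (fun _ _ => I).
  under eq_Rintegral do rewrite mulr1; under [in RHS]eq_Rintegral do rewrite mulr1.
  by move=> <- h0; rewrite /Rintegral h0.
rewrite toK//.
have -> : (\int[lebesgue_rV n]_(y in K) (h y * dV (u y) e))%R =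
    (\int[lebesgue_rV n]_(y in K) (h y * dV (u y - z) e))%R.
  transitivity (\int[lebesgue_rV n]_(y in K) (h y * dV (u y - z) e + dV z e * h y))%R.
    apply: eq_Rintegral => y _; rewrite dotDl dotNl; ring.
  rewrite RintegralD//; last exact: (integrableZl mK (dV z e) ih).
  by rewrite RintegralZl// h0 mulr0 addr0.
apply: le_trans (le_normr_Rintegral mK ihu) _.
rewrite -[leRHS]RintegralZl//; apply: le_Rintegral => //.
- by have := integrable_norm ihu.
- exact: (integrableZl mK (C / r * dnorm dV e) inorm).
- move=> y _ /=; rewrite normrM -mulrA.
  by rewrite ler_pM// [leRHS]mulrC cauchy_schwarz.
Qed.

End lebesgue_points.

(** * Decay of the density *)
Section distribution_on_bumps.
Context {R : realType} {n : nat} {V W : vectType R}.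
Variables (dV : {dot V for idfun}) (dW : {dot W for idfun}).
Variables (A : 'I_n -> 'Hom(V, W)) (Omega : set 'rV[R]_n) (u : 'rV[R]_n -> V).
Hypothesis n_gt0 : (0 < n)%N.
Hypothesis oO : open Omega.
Hypothesis uL1 : L1loc dV Omega u.

(** Expanding in a basis of [V], the vector is a combination of finitely many
    fixed vectors with coefficients
    [O(1 / r)] times the integral of [|u - z|], which is [o(r ^ n)]. *)
Lemma diff_operator_bump_small x : Omega x -> Lebesgue_point dV u x ->
  forall eps : R, 0 < eps -> exists2 d : R, 0 < d & forall r, 0 < r -> r < d ->
    [set y | `|x - y| <= r] `<=` Omega /\
    dnorm dW (diff_operator A (distribution_of Omega u) (bump x r)) <= eps * r ^+ n.-1.
Proof.
move=> Ox Lx eps eps0.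
have [z hz] := integral_closed_ball_Lebesgue_point oO uL1 Ox Lx.
have [C C0 hC] := @partial_bump_bound R n.
have /choice[e he] := coord_dot dV (vbasis {:V}).
pose b k := (vbasis {:V})`_k.
pose D : R := \sum_(i < n) \sum_(k < \dim {:V}) C * dnorm dV (e k) * dnorm dW (A i (b k)).
have D0 : 0 <= D.
  apply: sumr_ge0 => i _; apply: sumr_ge0 => k _.
  by rewrite mulr_ge0 ?mulr_ge0 ?dnorm_ge0.
have D10 : 0 < D + 1 by rewrite ltr_wpDl.
have [d d0 hd] := hz _ (divr_gt0 eps0 D10).
exists d => // r r0 rd; have [KO] := hd _ r0 rd; split => //.
set J := (\int[_]_(y in _) _)%E in b0 *.
have J0 : (0 <= J)%E by apply: integral_ge0 => y _; rewrite lee_fin dnorm_ge0.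
have Jfin : J \is a fin_num by rewrite ge0_fin_numE//; apply: le_lt_trans b0 _; rewrite ltry.
have {}b0 : fine J <= eps / (D + 1) * r ^+ n by rewrite -lee_fin fineK.
apply: (@le_trans _ _ (D / r * fine J)); last first.
  apply: (@le_trans _ _ (D / r * (eps / (D + 1) * r ^+ n))).
    by rewrite ler_wpM2l// mulr_ge0// invr_ge0 ltW.
  have -> : D / r * (eps / (D + 1) * r ^+ n) = D / (D + 1) * (eps * r ^+ n.-1).
    rewrite -{1}(prednK n_gt0) exprS; field; rewrite !gt_eqF//.
  rewrite ler_piMl//; first by rewrite mulr_ge0 ?exprn_ge0 ?ltW.
  by rewrite ler_pdivrMr// mul1r lerDl.
rewrite /diff_operator (le_trans (ler_dnorm_sum _ _ _ _))//.
rewrite /D !mulr_suml; apply: ler_sum => i _.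
rewrite /distr_partial linearN dnormN /distribution_of /vector_integral.
rewrite linear_sum (le_trans (ler_dnorm_sum _ _ _ _))// !mulr_suml.
apply: ler_sum => k _; rewrite linearZ dnormZ.
have -> : (\int[lebesgue_rV n]_(y in Omega)
     coord (vbasis {:V}) k (partial i (bump x r) y *: u y))%R =
   (\int[lebesgue_rV n]_(y in Omega) (partial i (bump x r) y * dV (u y) (e k)))%R.
  by apply: eq_Rintegral => y _; rewrite linearZ -he.
have h := Rintegral_partial_bump_bound oO uL1 z (e k) r0 KO (fun y => hC i x r y r0).
apply: (@le_trans _ _ (C / r * dnorm dV (e k) * fine J * dnorm dW (A i (b k)))).
  by rewrite ler_wpM2r ?dnorm_ge0.
rewrite le_eqVlt; apply/orP; left; apply/eqP; ring.
Qed.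

End distribution_on_bumps.

Section halving_iteration.
Context {R : realType}.

(** If [h <= 2 e + K] on [(0, t)], then [h <= 2 e + K / 2] on [(0, t / q)], where
    [e] is the error in the hypothesis. The first bound [K] comes from the
    values of [h] away from [0], which the hypothesis propagates to [0]. *)
Lemma halving_iteration (h : R -> R) (q d0 : R) : 1 < q -> 0 < d0 ->
  (forall a, 0 < a -> exists M, forall r, a <= r -> r < d0 -> h r <= M) ->
  (forall eps : R, 0 < eps -> exists2 d : R, 0 < d &
     forall r, 0 < r -> r < d -> h r <= eps + h (q * r) / 2) ->
  forall eps : R, 0 < eps -> exists2 d : R, 0 < d & forall r, 0 < r -> r < d -> h r <= eps.
Proof.
move=> q1 d00 hM hh eps eps0.
have q0 : 0 < q by apply: lt_trans q1.
pose e := eps / 3; have e0 : 0 < e by rewrite divr_gt0.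
have [d' d'0 hd'] := hh _ e0.
pose d := Num.min d' (d0 / q).
have dpos : 0 < d by rewrite lt_min d'0 divr_gt0.
have dd' : d <= d' by rewrite ge_min lexx.
have dq : q * d <= d0.
  by rewrite mulrC -ler_pdivlMr// ge_min lexx orbT.
have [M0 hM0] := hM _ dpos.
pose M := `|M0|.
have step r K : 0 < r -> r < d -> h (q * r) <= 2 * e + K -> h r <= 2 * e + K / 2.
  by move=> r0 rd hq; have := hd' _ r0 (lt_le_trans rd dd'); lra.
have M_ge0 : 0 <= M by exact: normr_ge0.
have base j r : d / q ^+ j <= r -> r < q * d -> h r <= 2 * e + M.
  elim: j r => [|j IH] r.
    rewrite expr0 divr1 => dr rd; have := hM0 _ dr (lt_le_trans rd dq).
    by have := ler_norm M0; rewrite -/M; lra.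
  have [dr _ rd|rd dr _] := leP d r.
    apply: (IH r) => //; apply: le_trans dr.
      rewrite ler_pdivrMr ?exprn_gt0// -[leLHS]mulr1 ler_pM2l//.
      by rewrite exprn_ege1// ltW.
  have r0 : 0 < r by apply: lt_le_trans dr; rewrite divr_gt0// exprn_gt0.
  apply: (@le_trans _ _ (2 * e + M / 2)); last by lra.
  apply: step => //; apply: IH.
    move: dr; rewrite !ler_pdivrMr ?exprn_gt0// exprS; rewrite mulrA (mulrC q r).
    by [].
  by rewrite ltr_pM2l.
have all_base r : 0 < r -> r < q * d -> h r <= 2 * e + M.
  move=> r0 rd.
  have [j hj] : exists j, d / r <= q ^+ j.
    pose p := q - 1; have p0 : 0 < p by rewrite subr_gt0.
    have bern k : 1 + k%:R * p <= q ^+ k.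
      elim: k => [|k IH]; first by rewrite mul0r addr0 expr0.
      rewrite exprS; apply: (@le_trans _ _ (q * (1 + k%:R * p))); last by rewrite ler_pM2l.
      have k0 : 0 <= k%:R :> R by [].
      have kp : 0 <= k%:R * p * p by rewrite !mulr_ge0// ltW.
      rewrite -natr1 (_ : q = 1 + p); last by rewrite /p addrC subrK.
      by nra.
    exists (Num.truncn (d / r / p)).+1; apply: le_trans (bern _).
    have := truncnS_gt (d / r / p); rewrite ltr_pdivrMr// => /ltW; lra.
  apply: (base j) => //; rewrite ler_pdivrMr ?exprn_gt0//.
  by move: hj; rewrite ler_pdivrMr// mulrC.
have improve j : exists2 t : R, 0 < t & forall r, 0 < r -> r < t -> h r <= 2 * e + M / 2 ^+ j.
  elim: j => [|j [t t0 ht]].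
    by exists (q * d); [rewrite mulr_gt0|move=> r; rewrite expr0 divr1; exact: all_base].
  exists (Num.min d (t / q)); first by rewrite lt_min dpos divr_gt0.
  move=> r r0; rewrite lt_min => /andP[rd rt].
  have -> : M / 2 ^+ j.+1 = M / 2 ^+ j / 2 by rewrite exprSr invfM mulrA.
  apply: step => //; apply: ht; first by rewrite mulr_gt0.
  by rewrite mulrC -ltr_pdivlMr.
have [j hj] : exists j : nat, M / e <= 2 ^+ j.
  exists (Num.truncn (M / e)).+1; apply: (@le_trans _ _ (Num.truncn (M / e)).+1%:R).
    exact/ltW/truncnS_gt.
  by rewrite -natrX ler_nat ltnW// ltn_expl.
have [t t0 ht] := improve j; exists t => // r r0 rt; apply: le_trans (ht _ r0 rt) _.
have : M / 2 ^+ j <= e.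
  by rewrite ler_pdivrMr ?exprn_gt0//; move: hj; rewrite ler_pdivrMr// mulrC.
by rewrite /e; lra.
Qed.

End halving_iteration.

Section conclusion.
Context {R : realType} {n : nat} {V W : vectType R}.
Variables (dV : {dot V for idfun}) (dW : {dot W for idfun}).
Variables (A : 'I_n -> 'Hom(V, W)) (Omega : set 'rV[R]_n) (u : 'rV[R]_n -> V).
Variable mu : set 'rV[R]_n -> W.
Hypothesis n_gt0 : (0 < n)%N.
Hypothesis oO : open Omega.
Hypothesis uL1 : L1loc dV Omega u.
Hypothesis muP : locally_bounded_measure dW Omega mu.
Hypothesis repr : represents_measure dW Omega mu (diff_operator A (distribution_of Omega u)).
Local Notation nu := (variation_measure dW Omega mu).

(** The exceptional set is the union, over an exhaustion of [Omega], of the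
    negligible sets of [exists_aligned_direction]. *)
Lemma negligible_positive_density :
  nu.-negligible [set x | [/\ Omega x, Lebesgue_point dV u x &
    limf_esup (fun r : R => (nu (eball x r) * (r ^- n.-1)%:E)%E) 0^'+ <> 0%E]].
Proof.
have [s sE] := exists_variation_measure oO muP.
have [D [oD cD UD]] := open_exhaustion oO.
have [c c0 hc] := @bump_lower_bound R n.
pose m := n.-1.
(* Dividing [lam * sigma B_(6 r)] by [c * (r / 2) ^ m] has to leave at most
   half of [sigma B_(6 r) / (6 r) ^ m]. *)
pose lam : R := c / (2 * 12 ^+ m).
have lam0 : 0 < lam by rewrite divr_gt0// mulr_gt0// exprn_gt0.
pose bad k := [set x | D k x /\ ~ exists w, dnorm dW w <= 1 /\
    exists2 d : R, 0 < d & forall r, 0 < r -> r < d ->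
      misalignment dW mu s w (ball x r `&` D k) <= lam * fine (s (ball x (6 * r) `&` D k))].
have mD k : measurable (D k) by exact: open_measurable_rV.
have : s.-negligible (\bigcup_k bad k).
  apply: negligible_bigcup => k.
  have nb := exists_aligned_direction oO muP sE (mD k) (cD k) (oD k) lam0.
  exact: nb.
move=> [N [mN sN badN]]; exists N; split => //; first by rewrite -sE.
move=> x [Ox Lx]; apply: contra_notP => nN.
have [k _ Dkx] : (\bigcup_k D k) x by rewrite UD.
have [w [w1 [d1 d10 hd1]]] : exists w, dnorm dW w <= 1 /\
    exists2 d : R, 0 < d & forall r, 0 < r -> r < d ->
      misalignment dW mu s w (ball x r `&` D k) <= lam * fine (s (ball x (6 * r) `&` D k)).
  by apply: contrapT => nw; apply: nN; apply: badN; exists k.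
have /nbhs_ballP[d2 /= d20 d2D] : nbhs x (D k) by exact: open_nbhs_nbhs.
have mb t : 0 < t -> measurable (ball x t).
  by move=> t0; apply: open_measurable_rV; exact: ball_open.
have cib t : t <= d2 -> compactly_inside Omega (ball x t).
  move=> td; apply: compactly_insideS (cD k); apply: subset_trans d2D.
  exact: le_ball.
pose h (r : R) := fine (s (ball x r)) / r ^+ m.
have sfin t : 0 < t -> t <= d2 -> s (ball x t) \is a fin_num.
  by move=> t0 td; apply: (s_fin_num oO muP sE); [exact: mb|exact: cib].
have small : forall eps : R, 0 < eps -> exists2 d : R, 0 < d &
    forall r, 0 < r -> r < d -> h r <= eps.
  apply: (@halving_iteration _ h 12 d2) => //.
  - by rewrite (_ : 1 = 1%:R)// ltr_nat.
  - move=> a a0; exists (fine (s (ball x d2)) / a ^+ m) => r ar rd.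
    have r0 : 0 < r by exact: lt_le_trans ar.
    apply: ler_pM; rewrite ?fine_ge0 ?invr_ge0 ?exprn_ge0 ?(ltW r0)//.
      apply: fine_le; [exact: sfin (ltW rd)|exact: sfin|].
      by apply: le_measure; rewrite ?inE; [exact: mb|exact: mb|exact/le_ball/ltW].
    by rewrite lef_pV2 ?posrE ?exprn_gt0// lerXn2r ?nnegrE ?(ltW r0) ?(ltW a0).
  - move=> eps eps0.
    pose eps' : R := eps * c / 2 ^+ m.
    have eps'0 : 0 < eps' by rewrite divr_gt0 ?mulr_gt0 ?exprn_gt0.
    have [d3 d30 hd3] :=
      diff_operator_bump_small dW A n_gt0 oO uL1 Ox Lx eps'0.
    exists (Num.min (d1 / 2) (Num.min (d2 / 12) (d3 / 2))).
      by rewrite !lt_min !divr_gt0.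
    move=> t t0; rewrite !lt_min => /and3P[td1 td2 td3].
    (* The bump of radius [r] controls the ball of radius [r / 2 = t]. *)
    pose r := 2 * t.
    have r0 : 0 < r by rewrite mulr_gt0.
    have rd1 : r < d1 by rewrite /r; lra.
    have rd2 : 6 * r < d2 by rewrite /r; lra.
    have rd3 : r < d3 by rewrite /r; lra.
    have rt : r / 2 = t by rewrite /r; field.
    have t12 : 6 * r = 12 * t by rewrite /r; ring.
    have [KO hT] := hd3 _ r0 rd3.
    have isI := repr (test_function_bump r0 KO).
    have Qin : compactly_inside Omega (ball x r) by apply: cib; lra.
    have t20 : 0 < r / 2 by rewrite rt.
    have := is_integral_lower_bound oO muP sE isI w1 c0 (mb _ t20) (mb _ r0) Qin
      (@bump_ge0 _ _ x r) (@bump_le1 _ _ x r) (fun y => hc x r y r0)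
      (fun y => @bump_eq0 _ _ x r y r0).
    rewrite rt => low.
    have := hd1 _ r0 rd1.
    have -> : ball x r `&` D k = ball x r.
      apply: setIidl; apply: subset_trans d2D; apply: le_ball; lra.
    have -> : ball x (6 * r) `&` D k = ball x (6 * r).
      apply: setIidl; apply: subset_trans d2D; apply: le_ball; lra.
    rewrite t12 => mis.
    have vw : dW (diff_operator A (distribution_of Omega u) (bump x r)) w <= eps' * r ^+ m.
      apply: le_trans hT; apply: le_trans (ler_norm _) _.
      by rewrite (le_trans (cauchy_schwarz _ _ _))// ler_piMr// dnorm_ge0.
    have ineq : c * fine (s (ball x t)) <= eps' * r ^+ m + lam * fine (s (ball x (12 * t))).
      by apply: le_trans low _; exact: lerD.
    have tm : 0 < t ^+ m by rewrite exprn_gt0.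
    rewrite /h ler_pdivrMr// -(ler_pM2l c0); apply: le_trans ineq _.
    rewrite le_eqVlt; apply/orP; left; apply/eqP.
    rewrite /eps' /lam /r !exprMn.
    by field; rewrite !gt_eqF ?exprn_gt0.
apply: limf_esup_eq0 => [r r0|eps eps0].
  rewrite mule_ge0 ?lee_fin ?invr_ge0 ?exprn_ge0 ?(ltW r0)//.
  by rewrite -sE ?measure_ge0//; exact: measurable_eball.
have [d d0 hd] := small _ eps0.
exists (Num.min d d2); first by rewrite lt_min d0.
move=> r r0; rewrite lt_min => /andP[rd rd2].
rewrite -sE; last exact: measurable_eball.
have le_s : (s (eball x r) <= s (ball x r))%E.
  by apply: le_measure; rewrite ?inE; [exact: measurable_eball|exact: mb|exact: eball_sub_ball].
apply: (@le_trans _ _ (s (ball x r) * (r ^- m)%:E)%E).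
  by apply: lee_wpmul2r => //; rewrite lee_fin invr_ge0 exprn_ge0// ltW.
by rewrite -(fineK (sfin _ r0 (ltW rd2))) -EFinM lee_fin; exact: hd.
Qed.

End conclusion.

Theorem theorem5 (R : realType) (n : nat) (n_gt0 : (0 < n)%N)
    (V W : vectType R) (dV : {dot V for idfun}) (dW : {dot W for idfun})
    (A : 'I_n -> 'Hom(V, W)) (Omega : set 'rV[R]_n) (u : 'rV[R]_n -> V)
    (mu : set 'rV[R]_n -> W) :
  open Omega ->
  L1loc dV Omega u ->
  locally_bounded_measure dW Omega mu ->
  represents_measure dW Omega mu (diff_operator A (distribution_of Omega u)) ->
  {ae variation_measure dW Omega mu, forall x, Omega x -> Lebesgue_point dV u x ->
    limf_esup (fun r : R =>
      (variation_measure dW Omega mu (eball x r) * (r ^- n.-1)%:E)%E) 0^'+ = 0%E}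
  /\ (variation_measure dW Omega mu).-negligible
       (Theta dW Omega mu n.-1 `\` discontinuity_set dV Omega u).
Proof.
move=> oO uL1 muP repr.
have [N [mN N0 subN]] := negligible_positive_density n_gt0 oO uL1 muP repr.
split; exists N; split => //; apply: subset_trans subN => x /=.
  by move=> /not_implyP[Ox /not_implyP[Lx lim0]]; split.
move=> [[Ox +] nS]; rewrite /upper_density => pos; split => //.
  by apply: contrapT => nL; apply: nS; split.
by move=> E; move: pos; rewrite E ltxx.
Qed.
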